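(* Let $W(3,2,2)$ be a four-dimensional three-web with a nonvanishing covector $a$ and with integrable transversal $a$-distribution $\Delta$. The two-dimensional three-webs $W(3,2,1)$ cut on the integral surfaces $V^2$ of the transversal $a$-distribution $\Delta$ by the foliations of the web $W(3,2,2)$ are hexagonal if and only if the torsion and curvature tensors of this web are connected (in a general admissible frame) by the relations $$b^1=0,\qquad b^2=0,$$ where $$b^i=\frac{1}{D^3}\bigl(-b^i_{111}a_2^3+3b^i_{(112)}a_2^2a_1-3b^i_{(122)}a_2a_1^2+b^i_{222}a_1^3\bigr),\qquad i=1,2,$$ and $D=a_1c_2-a_2c_1\neq0$ for arbitrarily chosen functions $c_1,c_2$.
   Context: A web $W(3,2,2)$ on a 4-manifold $M^4$ consists of three foliations $\lambda_1,\lambda_2,\lambda_3$ of codimension 2 in general position (their tangent planes are pairwise transversal at each point). All considerations are local. Indices $i,j,k,l$ range over $\{1,2\}$; repeated indices are summed; round (square) brackets around indices denote symmetrization (alternation) with averaging. The foliation $\lambda_u$ is given by $\omega_{(u)}^i=0$, $i=1,2$, where the 1-forms are normalized so that $\omega_{(1)}^i+\omega_{(2)}^i+\omega_{(3)}^i=0$; the forms $\omega_{(1)}^i,\omega_{(2)}^i$ form a coframe on $M^4$. Admissible coframe changes are $\omega_{(\alpha)}^{i'}=A^{i'}_j\omega_{(\alpha)}^j$ with the same nondegenerate matrix for $\alpha=1,2$. The structure equations are $$d\omega_{(1)}^i=\omega_{(1)}^j\wedge\omega_j^i+a_j\omega_{(1)}^j\wedge\omega_{(1)}^i,\qquad d\omega_{(2)}^i=\omega_{(2)}^j\wedge\omega_j^i-a_j\omega_{(2)}^j\wedge\omega_{(2)}^i,$$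 which determine the connection forms $\omega_j^i$ and the covector $a=\{a_1,a_2\}$ (the torsion tensor being $a^i_{jk}=a_{[j}\delta^i_{k]}$), together with $$d\omega_j^i-\omega_j^k\wedge\omega_k^i=b^i_{jkl}\,\omega_{(1)}^k\wedge\omega_{(2)}^l,\qquad da_i-a_j\omega_i^j=p_{ij}\omega_{(1)}^j+q_{ij}\omega_{(2)}^j,$$ where $b^i_{jkl}$ is the curvature tensor, with $b^i_{[j|l|k]}=\delta^i_{[k}p_{j]l}$, $b^i_{[jk]l}=\delta^i_{[k}q_{j]l}$. The transversal $a$-distribution $\Delta$ is defined by $a_1\omega_{(1)}^1+a_2\omega_{(1)}^2=0$, $a_1\omega_{(2)}^1+a_2\omega_{(2)}^2=0$. On each two-dimensional integral surface $V^2$ of $\Delta$ the leaves of the three foliations cut a web $W(3,2,1)$ of three one-dimensional foliations. A two-dimensional three-web is hexagonal if it is locally diffeomorphic to the web of three families of parallel straight lines in the plane; equivalently, its (Blaschke) curvature vanishes. The functions $c_1,c_2$ arise from an auxiliary coframe $\omega_{(\alpha)}^{1'}=a_1\omega_{(\alpha)}^1+a_2\omega_{(\alpha)}^2$, $\omega_{(\alpha)}^{2'}=c_1\omega_{(\alpha)}^1+c_2\omega_{(\alpha)}^2$ ($\alpha=1,2$), whose second pair of forms is chosen arbitrarily subject to $D\neq0$. The quantity $b^i$ is the contraction $b^i=b^i_{jkl}v^jv^kv^l$ with $v=\frac1D(-a_2,a_1)$. *)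

(* Defs.v *)
(* All considerations are local: the manifold
   M^n is an open set U of R^n = 'rV[R]_n, tangent vectors at every point are
   elements of 'rV[R]_n, and the class of differentiability is C^oo. *)
From HB Require Import structures.
From mathcomp Require Import all_boot all_order all_algebra.
From mathcomp Require Import all_classical all_reals all_analysis.

Set Implicit Arguments.
Unset Strict Implicit.
Unset Printing Implicit Defensive.

Import Order.TTheory GRing.Theory Num.Theory.
Import numFieldNormedType.Exports.

Local Open Scope classical_set_scope.
Local Open Scope ring_scope.

Section Calculus.
Context {R : realType}.

(* For open U, f is C^(k+1) on U iff it is differentiable on U and all its
   directional derivatives are C^k on U. *)
Fixpoint Ck {n} {V : normedModType R} (k : nat) (U : set 'rV[R]_n)
    (f : 'rV[R]_n -> V) : Prop :=
  match k with
  | 0%N => forall x, U x -> {for x, continuous f}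
  | k'.+1 => (forall x, U x -> differentiable f x) /\
             forall v : 'rV[R]_n, Ck k' U ('D_v f)
  end.

Definition smooth {n} {V : normedModType R} (U : set 'rV[R]_n)
    (f : 'rV[R]_n -> V) : Prop := forall k, Ck k U f.

Definition is_diffeo {n} (N N' : set 'rV[R]_n) (phi : 'rV[R]_n -> 'rV[R]_n)
    : Prop :=
  [/\ open N, open N', phi @` N = N', smooth N phi &
      exists2 psi : 'rV[R]_n -> 'rV[R]_n,
        smooth N' psi & forall s, N s -> psi (phi s) = s].

End Calculus.

(* A 1-form is the field of the columns of its coefficients in the standard
   coordinates. *)
Definition one_form (R : realType) (n : nat) := 'rV[R]_n -> 'cV[R]_n.

(* Distributions are fields of sets of tangent vectors; a foliation is given
   by the distribution of the tangent planes of its leaves. *)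
Definition vdistribution (R : realType) (n : nat) := 'rV[R]_n -> set 'rV[R]_n.

Section Forms.
Context {R : realType} {n : nat}.
Implicit Types (th al be : one_form R n) (x v w : 'rV[R]_n).

Definition ev th x v : R := (v *m th x) 0 0.

Definition wedge1 al be x v w : R :=
  ev al x v * ev be x w - ev al x w * ev be x v.

(* v and w are extended to constant (hence commuting) vector fields *)
Definition ext_d th x v w : R :=
  'D_v (fun y => ev th y w) x - 'D_w (fun y => ev th y v) x.

(* Locally the leaves are the level sets of a submersion onto an open subset
   of R^q. *)
Definition is_foliation (q : nat) (U : set 'rV[R]_n) (T : vdistribution R n)
    : Prop :=
  forall x, U x -> exists (N : set 'rV[R]_n) (f : 'rV[R]_n -> 'rV[R]_q),
    [/\ open N, N x, N `<=` U, smooth N f &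
        forall y, N y ->
          (forall z : 'rV[R]_q, exists v, 'd f y v = z) /\
          T y = [set v | 'd f y v = 0]].

(* W is an open set of parameters of the (immersed) surface. *)
Definition integral_surface (U : set 'rV[R]_n) (Delta : vdistribution R n)
    (W : set 'rV[R]_2) (f : 'rV[R]_2 -> 'rV[R]_n) : Prop :=
  [/\ open W, smooth W f, (forall s, W s -> U (f s)) &
      forall s, W s -> injective ('d f s) /\ range ('d f s) = Delta (f s)].

Definition integrable_distribution (U : set 'rV[R]_n)
    (Delta : vdistribution R n) : Prop :=
  forall x, U x -> exists W f s,
    [/\ integral_surface U Delta W f, W s & f s = x].

End Forms.

Section Webs.
Context {R : realType}.

(* Transversality of two 2-planes in R^4: together they span R^4. *)
Definition web322 (U : set 'rV[R]_4) (lam : 'I_3 -> vdistribution R 4) : Prop :=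
  (forall u, is_foliation 2 U (lam u)) /\
  (forall u u' x, u != u' -> U x ->
    forall z, exists v v', [/\ lam u x v, lam u' x v' & z = v + v']).

(* On the parameter domain of f, the lines tangent to the intersections of the
   surface with the leaves of the web. *)
Definition cut_web {n} (lam : 'I_3 -> vdistribution R n)
    (f : 'rV[R]_2 -> 'rV[R]_n) : 'I_3 -> vdistribution R 2 :=
  fun u s => [set w | lam u (f s) ('d f s w)].

(* e u is the direction of the u-th family of parallel straight lines. *)
Definition hexagonal (W : set 'rV[R]_2) (F : 'I_3 -> vdistribution R 2)
    : Prop :=
  forall s, W s -> exists (N N' : set 'rV[R]_2) (phi : 'rV[R]_2 -> 'rV[R]_2)
      (e : 'I_3 -> 'rV[R]_2),
    [/\ N s, N `<=` W, is_diffeo N N' phi,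
        (forall u u', u != u' -> row_free (col_mx (e u) (e u'))) &
        forall u t, N t -> F u t = [set w | ('d phi t w <= e u)%MS]].

(* Index conventions: the web indices 1, 2, 3 are 0, 1, 2 : 'I_3 and the tensor
   indices 1, 2 are 0, 1 : 'I_2.  omega u i is omega_(u)^i. *)
Definition normalized_coframe (U : set 'rV[R]_4)
    (lam : 'I_3 -> vdistribution R 4)
    (omega : 'I_3 -> 'I_2 -> one_form R 4) : Prop :=
  [/\ (forall u i, smooth U (omega u i)),
      (forall u x, U x -> lam u x = [set v | forall i, ev (omega u i) x v = 0]),
      (forall i x, U x -> \sum_u omega u i x = 0) &
      forall x (k1 k2 : 'I_2 -> R), U x ->
        \sum_i (k1 i *: omega 0 i x + k2 i *: omega 1 i x) = 0 ->
        forall i, k1 i = 0 /\ k2 i = 0].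

Definition kron (i j : 'I_2) : R := (i == j)%:R.

(* conn j i is the connection form omega_j^i (lower index first), b i j k l is
   the component b^i_{jkl}. *)
Record structure_equations (U : set 'rV[R]_4)
    (omega : 'I_3 -> 'I_2 -> one_form R 4)
    (conn : 'I_2 -> 'I_2 -> one_form R 4)
    (a : 'I_2 -> 'rV[R]_4 -> R)
    (b : 'I_2 -> 'I_2 -> 'I_2 -> 'I_2 -> 'rV[R]_4 -> R)
    (p q : 'I_2 -> 'I_2 -> 'rV[R]_4 -> R) : Prop := {
  conn_smooth : forall i j, smooth U (conn j i);
  covector_smooth : forall i, smooth U (a i);
  struct_omega1 : forall i x v w, U x ->
    ext_d (omega 0 i) x v w =
      \sum_j wedge1 (omega 0 j) (conn j i) x v w
      + \sum_j a j x * wedge1 (omega 0 j) (omega 0 i) x v w;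
  struct_omega2 : forall i x v w, U x ->
    ext_d (omega 1 i) x v w =
      \sum_j wedge1 (omega 1 j) (conn j i) x v w
      - \sum_j a j x * wedge1 (omega 1 j) (omega 1 i) x v w;
  struct_conn : forall i j x v w, U x ->
    ext_d (conn j i) x v w - \sum_k wedge1 (conn j k) (conn k i) x v w =
      \sum_k \sum_l b i j k l x * wedge1 (omega 0 k) (omega 1 l) x v w;
  struct_a : forall i x v, U x ->
    'D_v (a i) x - \sum_j a j x * ev (conn i j) x v =
      \sum_j (p i j x * ev (omega 0 j) x v + q i j x * ev (omega 1 j) x v);
  (* b^i_{[j|l|k]} = delta^i_{[k} p_{j]l} *)
  curv_p : forall i j k l x, U x ->
    (b i j l k x - b i k l j x) / 2 =
      (kron i k * p j l x - kron i j * p k l x) / 2;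
  (* b^i_{[jk]l} = delta^i_{[k} q_{j]l} *)
  curv_q : forall i j k l x, U x ->
    (b i j k l x - b i k j l x) / 2 =
      (kron i k * q j l x - kron i j * q k l x) / 2 }.

Definition a_distribution (omega : 'I_3 -> 'I_2 -> one_form R 4)
    (a : 'I_2 -> 'rV[R]_4 -> R) : vdistribution R 4 :=
  fun x => [set v | a 0 x * ev (omega 0 0) x v + a 1 x * ev (omega 0 1) x v = 0 /\
                    a 0 x * ev (omega 1 0) x v + a 1 x * ev (omega 1 1) x v = 0].

Definition coframe_det (a c : 'I_2 -> 'rV[R]_4 -> R) (x : 'rV[R]_4) : R :=
  a 0 x * c 1 x - a 1 x * c 0 x.

Definition sym3 (t : 'I_2 -> 'I_2 -> 'I_2 -> R) (j k l : 'I_2) : R :=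
  (t j k l + t j l k + t k j l + t k l j + t l j k + t l k j) / 6.

Definition b_contr (a c : 'I_2 -> 'rV[R]_4 -> R)
    (b : 'I_2 -> 'I_2 -> 'I_2 -> 'I_2 -> 'rV[R]_4 -> R)
    (i : 'I_2) (x : 'rV[R]_4) : R :=
  let bi j k l := b i j k l x in
  1 / coframe_det a c x ^+ 3 *
  (- bi 0 0 0 * a 1 x ^+ 3
   + 3 * sym3 bi 0 0 1 * a 1 x ^+ 2 * a 0 x
   - 3 * sym3 bi 0 1 1 * a 1 x * a 0 x ^+ 2
   + bi 1 1 1 * a 0 x ^+ 3).

End Webs.

(* Main.v *)
(** Let [v = (-a_2, a_1) / D].  On an integral surface of the [a]-distribution
    [omega_(u)^i = v^i theta_u] with [theta_u = c_i omega_(u)^i], and the structure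
    equations give [d theta_u = theta_u /\ gamma] for [u = 1, 2], where [gamma] is
    the contraction of [dv^i + v^j omega_j^i] with [c].  Contracting them with [a]
    instead shows that [dv^i + v^j omega_j^i = v^i gamma], and exterior
    differentiation of this equation yields
    [v^i d gamma = b^i theta_1 /\ theta_2].  So everything reduces to the claim
    that the plane web [theta_1 = 0], [theta_2 = 0], [theta_1 + theta_2 = 0] is
    hexagonal iff [d gamma = 0].  If it is hexagonal, the linear coordinates of a
    straightening map give closed forms [g theta_u] with a common factor [g], hence
    [dg = g gamma] and [d gamma = 0].  Conversely, if locally [gamma = dh], the
    forms [e^h theta_u] are closed, and their primitives are the coordinates of a
    straightening map. *)

Require Import Defs.
From HB Require Import structures.
From mathcomp Require Import all_boot all_order all_algebra.
From mathcomp Require Import all_classical all_reals all_analysis.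
From mathcomp Require Import ring lra.
Import Order.TTheory GRing.Theory Num.Theory.
Import numFieldNormedType.Exports.
Local Open Scope classical_set_scope.
Local Open Scope ring_scope.

Set Implicit Arguments.
Unset Strict Implicit.

(** * Functions of class C^k *)

Section CkTheory.
Context {R : realType}.

(** The torsion terms of the first two families differ in sign, but on an integral surface they
    contain the factor [a_j omega_(u)^j = 0]. This is why both families share one [gamma]. The
    contraction with [a] yields [theta_u /\ (a_i (dv^i + v^j omega_j^i)) = 0] for [u = 1, 2]; in the
    plane, a 1-form whose exterior product with two independent 1-forms vanishes is zero.
    Hexagonality is stated through a local diffeomorphism, so the converse has to produce one
    together with a smooth inverse. The closed forms are integrated on a ball by a radial integral,
    and the map made of the primitives is normalized to have the identity as differential at the
    base point, so that its inverse comes from a contraction. Both arguments are carried out for the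
    recursive notion [Ck], in which derivatives are taken in constant directions only. *)

Lemma diff_normP {V W : normedModType R} (f : V -> W) (x : V) (L : {linear V -> W}) :
  continuous L ->
  (forall e : R, 0 < e ->
     \forall y \near x, `|f y - f x - L (y - x)| <= e * `|y - x|) <->
  is_diff x f L.
Proof.
move=> cL; split=> [H|[df dfL] e e0].
  have E : f \o shift x = cst (f x) + L +o_ 0 id.
    apply/eqaddoP => e e0; have := H e e0.
    rewrite (near_shift 0 x) subr0; apply: filterS => y /=.
    by rewrite /= addrK !fctE opprD addrA.
  have dE := diff_unique cL E.
  apply: DiffDef => //.
  by apply/diff_locallyP; rewrite dE.
have [_ /eqaddoP/(_ e e0)] := (diff_locallyP _ _).1 df.
rewrite (near_shift 0 x) subr0; apply: filterS => y /=.
by rewrite !fctE /= addrK -dfL opprD addrA.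
Qed.

Arguments diff_normP {V W} f x {L}.

Lemma near_eq_differentiable {V W : normedModType R} (f g : V -> W) x :
  (\forall y \near x, f y = g y) -> differentiable f x -> differentiable g x.
Proof.
move=> fg df; have fgx := nbhs_singleton fg.
have dfx : continuous ('d f x) by exact: diff_continuous.
suff [dg _] : is_diff x g ('d f x) by exact: dg.
apply: (diff_normP g x dfx).1 => e e0.
have := (diff_normP f x dfx).2 (differentiableP df) e e0.
by apply: filterS2 fg => y fgy; rewrite fgy fgx.
Qed.

Lemma near_open {T : topologicalType} (U : set T) x :
  open U -> U x -> \forall y \near x, U y.
Proof. by move=> oU Ux; exact: open_nbhs_nbhs. Qed.

Section OnOpen.
Context {n : nat}.
Implicit Types (U : set 'rV[R]_n) (k : nat).

(** Since [U] is open, functions that agree on [U] agree near each of its points and so have the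
    same derivatives there. The inductions on [k] below use this to replace a derivative by a
    formula that is valid on [U] only. *)
Lemma eq_Ck {V : normedModType R} k U (f g : 'rV[R]_n -> V) :
  open U -> (forall x, U x -> f x = g x) -> Ck k U f -> Ck k U g.
Proof.
move=> oU; elim: k f g => [|k IH] f g fg.
  move=> /= cf x Ux; have fgx : \forall y \near x, f y = g y.
    by have := near_open oU Ux; apply: filterS => y /fg.
  rewrite /prop_for /continuous_at -fg//.
  exact: cvg_trans (near_eq_cvg fgx) (cf x Ux).
have nfg x : U x -> \forall y \near x, f y = g y.
  by move=> Ux; have := near_open oU Ux; apply: filterS => y /fg.
move=> /= [df Df]; split=> [x Ux|v]; last first.
  by apply: IH (Df v) => x Ux; exact/near_eq_derive/nfg.
exact: near_eq_differentiable (nfg x Ux) (df x Ux).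
Qed.

Lemma Ck_sub {V : normedModType R} k U U' (f : 'rV[R]_n -> V) :
  U' `<=` U -> Ck k U f -> Ck k U' f.
Proof.
move=> sU; elim: k f => [|k IH] f /=; first by move=> cf x /sU/cf.
by move=> [df Df]; split=> [x /sU/df//|v]; exact: IH.
Qed.

Lemma CkW {V : normedModType R} k U (f : 'rV[R]_n -> V) : Ck k.+1 U f -> Ck k U f.
Proof.
elim: k f => [|k IH] f [df Df].
  by move=> x Ux; exact/differentiable_continuous/df.
by split=> // v; exact/IH/Df.
Qed.

Lemma Ck_cst {V : normedModType R} k U (c : V) : Ck k U (fun _ => c).
Proof.
elim: k c => [|k IH] c /=; first by move=> x _; exact: cst_continuous.
split=> [x _|v]; first exact: differentiable_cst.
have -> : 'D_v (fun _ : 'rV[R]_n => c) = (fun _ => 0) :> (_ -> _).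
  by apply/funext => x; exact: derive_cst.
exact: IH.
Qed.

Lemma CkD {V : normedModType R} k U (f g : 'rV[R]_n -> V) : open U ->
  Ck k U f -> Ck k U g -> Ck k U (fun x => f x + g x).
Proof.
move=> oU; elim: k f g => [|k IH] f g.
  by move=> /= cf cg x Ux; exact: cvgD (cf x Ux) (cg x Ux).
move=> [df Df] [dg Dg]; split=> [x Ux|v].
  by apply: differentiableD; [exact: df|exact: dg].
apply: (eq_Ck oU _ ((IH _ _ (Df v) (Dg v)))) => x Ux.
by rewrite [RHS]deriveD//; apply: diff_derivable; first [exact: df|exact: dg].
Qed.

Lemma CkZl {V : normedModType R} k U (h : 'rV[R]_n -> R) (c : V) :
  open U -> Ck k U h -> Ck k U (fun x => h x *: c).
Proof.
move=> oU; elim: k h => [|k IH] h.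
  by move=> /= ch x Ux; exact: cvgZr_tmp (ch x Ux).
move=> [dh Dh]; split=> [x Ux|v]; first exact/differentiableZl/dh.
apply: (eq_Ck oU _ (IH _ (Dh v))) => x Ux.
have dhx := dh x Ux.
by rewrite !deriveE//; [rewrite diffZl|exact: differentiableZl].
Qed.

Lemma CkM k U (f g : 'rV[R]_n -> R) : open U ->
  Ck k U f -> Ck k U g -> Ck k U (fun x => f x * g x).
Proof.
move=> oU; elim: k f g => [|k IH] f g.
  by move=> /= cf cg x Ux; exact: cvgM (cf x Ux) (cg x Ux).
move=> fS gS; have [df Df] := fS; have [dg Dg] := gS; split=> [x Ux|v].
  by apply: differentiableM; [exact: df|exact: dg].
apply: (eq_Ck oU _ (CkD oU (IH _ _ (CkW fS) (Dg v)) (IH _ _ (CkW gS) (Df v)))).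
by move=> x Ux; rewrite [RHS]deriveM//; apply: diff_derivable; first [exact: df|exact: dg].
Qed.

Lemma CkN k U (f : 'rV[R]_n -> R) : open U ->
  Ck k U f -> Ck k U (fun x => - f x).
Proof.
move=> oU Cf; apply: (eq_Ck oU _ (CkM oU (Ck_cst k U (-1 : R)) Cf)) => x _.
by rewrite mulN1r.
Qed.

Lemma Ck_sum {V : normedModType R} {I : Type} k U (r : seq I) (P : pred I)
    (F : I -> 'rV[R]_n -> V) : open U ->
  (forall i, P i -> Ck k U (F i)) -> Ck k U (fun x => \sum_(i <- r | P i) F i x).
Proof.
move=> oU CF; elim: r => [|i r IH].
  by apply: (eq_Ck oU _ ((Ck_cst k U (0 : V)))) => x _; rewrite big_nil.
case Pi: (P i).
  by apply: (eq_Ck oU _ ((CkD oU (CF i Pi) IH))) => x _; rewrite big_cons Pi.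
by apply: (eq_Ck oU _ (IH)) => x _; rewrite big_cons Pi.
Qed.

Lemma Ck_prod {I : Type} k U (r : seq I) (P : pred I)
    (F : I -> 'rV[R]_n -> R) : open U ->
  (forall i, P i -> Ck k U (F i)) -> Ck k U (fun x => \prod_(i <- r | P i) F i x).
Proof.
move=> oU CF; elim: r => [|i r IH].
  by apply: (eq_Ck oU _ ((Ck_cst k U (1 : R)))) => x _; rewrite big_nil.
case Pi: (P i).
  by apply: (eq_Ck oU _ ((CkM oU (CF i Pi) IH))) => x _; rewrite big_cons Pi.
by apply: (eq_Ck oU _ (IH)) => x _; rewrite big_cons Pi.
Qed.

Lemma CkV k U (f : 'rV[R]_n -> R) : open U -> (forall x, U x -> f x != 0) ->
  Ck k U f -> Ck k U (fun x => (f x)^-1).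
Proof.
move=> oU f0; elim: k => [|k IH].
  by move=> /= cf x Ux; exact: cvgV (f0 x Ux) (cf x Ux).
move=> fS; have [df Df] := fS; split=> [x Ux|v].
  by apply: differentiableV; [exact: df|exact: f0].
have Ci := IH (CkW fS).
apply: (eq_Ck oU _ (CkN oU (CkM oU (CkM oU Ci Ci) (Df v)))) => x Ux.
rewrite [RHS]deriveV ?f0//; last exact/diff_derivable/df.
by rewrite scaleNr expr2 invfM.
Qed.

Lemma differentiable_mx {V : normedModType R} {p q} (f : V -> 'M[R]_(p, q)) x :
  (forall i j, differentiable (fun y => f y i j) x) -> differentiable f x.
Proof.
move=> df.
rewrite (_ : f = \sum_i \sum_j (fun y => f y i j *: delta_mx i j)).
  apply: differentiable_sum => i; apply: differentiable_sum => j.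
  exact/differentiableZl.
apply/funext => y; rewrite {1}[f y]matrix_sum_delta fct_sumE.
by apply: eq_bigr => i _; rewrite fct_sumE.
Qed.

Lemma differentiable_entry {V : normedModType R} {p q} (f : V -> 'M[R]_(p, q)) x i j :
  differentiable f x -> differentiable (fun y => f y i j) x.
Proof.
by move=> df; exact: (differentiable_comp df (differentiable_coord _ i j)).
Qed.

Lemma derive_entry {V : normedModType R} {p q} (f : V -> 'M[R]_(p, q)) x v i j :
  differentiable f x -> 'D_v (fun y => f y i j) x = 'D_v f x i j.
Proof. by move=> df; rewrite derive_mx ?mxE//; exact: diff_derivable. Qed.

Lemma Ck_mxP {p q} k U (f : 'rV[R]_n -> 'M[R]_(p, q)) : open U ->
  Ck k U f <-> forall i j, Ck k U (fun y => f y i j).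
Proof.
move=> oU; split.
  elim: k f => [|k IH] f /=.
    move=> cf i j x Ux.
    exact: continuous_comp (cf x Ux) (@coord_continuous _ _ _ i j (f x)).
  move=> [df Df] i j; split=> [x Ux|v]; first exact/differentiable_entry/df.
  apply: (eq_Ck oU _ ((IH _ (Df v) i j))) => x Ux.
  by rewrite derive_entry//; exact: df.
move=> Cf; apply: (@eq_Ck _ k U
  (fun x => \sum_i \sum_j f x i j *: delta_mx i j)) => // [x _|].
  by rewrite -matrix_sum_delta.
by do 2 (apply: Ck_sum => // ? _); exact: CkZl.
Qed.

End OnOpen.

Lemma derive_delta {n} {V : normedModType R} (g : 'rV[R]_n -> V) y v :
  differentiable g y -> 'D_v g y = \sum_i v 0 i *: 'D_(delta_mx 0 i) g y.
Proof.
move=> dg; rewrite deriveE// {1}[v]row_sum_delta linear_sum.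
by apply: eq_bigr => i _; rewrite linearZ/= deriveE.
Qed.

Lemma derive_comp {m} {V W : normedModType R} (f : 'rV[R]_m -> V) (g : V -> W) x v :
  differentiable f x -> differentiable g (f x) ->
  'D_v (g \o f) x = 'D_('D_v f x) g (f x).
Proof.
move=> df dg; rewrite !deriveE//; last exact: differentiable_comp.
by rewrite diff_comp.
Qed.

(** The chain rule differentiates [g] in the direction ['D_v f x], which varies with [x]. Expanding
    that direction over the standard basis leaves partial derivatives of [g] in constant directions,
    to which the induction hypothesis applies. *)
Lemma Ck_comp {m n} k (W : set 'rV[R]_m) (U : set 'rV[R]_n)
    (f : 'rV[R]_m -> 'rV[R]_n) (g : 'rV[R]_n -> R) :
  open W -> (forall s, W s -> U (f s)) -> Ck k W f -> Ck k U g ->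
  Ck k W (g \o f).
Proof.
move=> oW WU; elim: k g => [|k IH] g.
  move=> /= cf cg x Wx; apply: continuous_comp; first exact: cf.
  exact/cg/WU.
move=> fS [dg Dg]; have [df Df] := fS.
split=> [x Wx|v]; first by apply: differentiable_comp; [exact: df|exact/dg/WU].
apply: (@eq_Ck _ _ k W (fun x => \sum_i ('D_v f x) 0 i *
    ('D_(delta_mx 0 i) g \o f) x)) => // [x Wx|].
  have [dfx dgx] := (df x Wx, dg _ (WU x Wx)).
  by rewrite (derive_comp v dfx dgx) (derive_delta _ dgx).
apply: Ck_sum => // i _; apply: CkM => //.
  exact: ((Ck_mxP _ _ oW).1 (Df v)).
exact: IH (CkW fS) (Dg _).
Qed.

End CkTheory.

(** * Mean value theorem and symmetry of second derivatives *)

Section MeanValue.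
Context {R : realType}.

Lemma near_norm_lt {V : normedModType R} (x : V) (P : set V) :
  (\forall y \near x, P y) ->
  exists2 r : R, 0 < r & forall y, `|y - x| < r -> P y.
Proof.
move=> /nbhs_ballP[r /= r0 H]; exists r => // y yx; apply: H.
by rewrite -ball_normE /ball_/= distrC.
Qed.

Lemma norm_lt_near {V : normedModType R} (x : V) (P : set V) (r : R) : 0 < r ->
  (forall y, `|y - x| < r -> P y) -> \forall y \near x, P y.
Proof.
move=> r0 H; apply/nbhs_ballP; exists r => // y.
by rewrite -ball_normE /ball_/= distrC; exact: H.
Qed.

Lemma near_dist_le {V W : normedModType R} (f : V -> W) (x : V) (e : R) :
  {for x, continuous f} -> 0 < e -> \forall y \near x, `|f y - f x| <= e.
Proof.
move=> cf e0; have : nbhs x (fun y => `|f x - f y| <= e).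
  exact: ((@cvgrPdist_le _ _ _ (nbhs x) (nbhs_filter x) f (f x)).1 cf e e0).
by apply: filterS => y; rewrite distrC.
Qed.

Lemma is_derive_line {V W : normedModType R} (f : V -> W) (x v : V) (t : R) :
  derivable f (x + t *: v) v ->
  is_derive t 1 (fun r => f (x + r *: v)) ('D_v f (x + t *: v)).
Proof.
move=> df.
have E : (fun h : R => h^-1 *: (((fun r => f (x + r *: v)) \o shift t) (h *: 1)
      - f (x + t *: v)))
    = (fun h => h^-1 *: ((f \o shift (x + t *: v)) (h *: v) - f (x + t *: v))).
  apply/funext => h; congr (_ *: (f _ - _)) => /=.
  by rewrite [h%:A]mulr1 scalerDl addrCA.
by apply: DeriveDef; [rewrite /derivable E|rewrite /derive E].
Qed.

Lemma segment_MVT {V : normedModType R} (u : V -> R) (x v : V) (t : R) : 0 < t ->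
  (forall r, 0 <= r <= t -> derivable u (x + r *: v) v) ->
  exists2 r, 0 <= r <= t & u (x + t *: v) - u x = 'D_v u (x + r *: v) * t.
Proof.
move=> t0 du.
have D r : 0 <= r <= t ->
    is_derive r 1 (fun r => u (x + r *: v)) ('D_v u (x + r *: v)).
  by move=> rt; exact/is_derive_line/du.
have [||c] := @MVT_segment R (fun r => u (x + r *: v))
  (fun r => 'D_v u (x + r *: v)) 0 t (ltW t0).
- by move=> r; rewrite in_itv/= => /andP[r0 rt]; apply: D; rewrite !ltW.
- apply: derivable_within_continuous => r; rewrite in_itv/= => rt.
  by have [] := D r rt.
rewrite in_itv/= => ct; rewrite scale0r addr0 subr0 => E.
by exists c.
Qed.

(** Two applications of the mean value theorem: to the increment [u y = f (y + t *: w) - f y] along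
    [v], then to ['D_v f] along [w]. *)
Lemma second_difference {n} (U : set 'rV[R]_n) (f : 'rV[R]_n -> R) (x v w : 'rV[R]_n) (t : R) :
  0 < t -> Ck 2 U f ->
  (forall r s, 0 <= r <= t -> 0 <= s <= t -> U (x + r *: v + s *: w)) ->
  exists r s, [/\ 0 <= r <= t, 0 <= s <= t &
    f (x + t *: v + t *: w) - f (x + t *: v) - (f (x + t *: w) - f x) =
    'D_w ('D_v f) (x + r *: v + s *: w) * (t * t)].
Proof.
move=> t0 [df Df] Ux.
have t00 : (0 : R) <= 0 <= t by rewrite lexx ltW.
have tt : 0 <= t <= t by rewrite lexx ltW.
pose u y := f (y + t *: w) - f y.
have dsh r : 0 <= r <= t -> differentiable (fun y => f (y + t *: w)) (x + r *: v).
  move=> rt; apply: (@differentiable_comp _ _ _ _ (fun y => y + t *: w) f).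
    by apply: differentiableD => //; exact: differentiable_cst.
  exact/df/Ux.
have df0 r : 0 <= r <= t -> differentiable f (x + r *: v).
  by move=> rt; apply: df; have := Ux r 0 rt t00; rewrite scale0r addr0.
have du r : 0 <= r <= t -> derivable u (x + r *: v) v.
  by move=> rt; apply: diff_derivable; apply: differentiableB; [exact: dsh|exact: df0].
have [r rt E] := segment_MVT t0 du.
have [|s st E'] := @segment_MVT _ ('D_v f) (x + r *: v) w t t0.
  by move=> s st; apply/diff_derivable/(Df v).1/Ux.
exists r, s; split => //.
have -> : f (x + t *: v + t *: w) - f (x + t *: v) - (f (x + t *: w) - f x) =
  u (x + t *: v) - u x by [].
rewrite mulrA -E' E; congr (_ * _).
have dshr := dsh r rt; have dfr := df0 r rt.
have dD : differentiable (fun y => y + t *: w) (x + r *: v).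
  by apply: differentiableD => //; exact: differentiable_cst.
apply: etrans (deriveB _ _) _; [exact: diff_derivable..|].
suff -> : 'D_v (fun y => f (y + t *: w)) (x + r *: v) =
    'D_v f (x + r *: v + t *: w) by [].
apply: etrans (derive_comp v dD (df _ (Ux r t rt tt))) _.
have -> : 'D_v (fun y => y + t *: w) (x + r *: v) = v; last by [].
apply: etrans (deriveD _ _) _; [exact: derivable_id|exact: derivable_cst|].
by rewrite derive_id derive_cst addr0.
Qed.

(* Both iterated derivatives are limits of the same second difference quotient. *)
Lemma derive_swap {n} (U : set 'rV[R]_n) (f : 'rV[R]_n -> R) (x v w : 'rV[R]_n) :
  open U -> Ck 2 U f -> U x -> 'D_v ('D_w f) x = 'D_w ('D_v f) x.
Proof.
move=> oU f2 Ux.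
apply/eqP; rewrite -subr_eq0 -normr_le0; apply/ler_addgt0Pr => e e0.
rewrite add0r.
have cv := (f2.2 v).2 w x Ux; have cw := (f2.2 w).2 v x Ux.
have e2 : 0 < e / 2 by rewrite divr_gt0.
have [d d0 Hd] := near_norm_lt (filterI (near_open oU Ux)
  (filterI ((cvgrPdist_le _ _).1 cv _ e2) ((cvgrPdist_le _ _).1 cw _ e2))).
(* With this side length the whole parallelogram at [x] stays in the ball of radius [d]; the summand
   1 keeps the denominator positive and the inclusion strict. *)
pose t := d / (`|v| + `|w| + 1).
have k0 : 0 < `|v| + `|w| + 1 by rewrite ltr_wpDl// addr_ge0.
have t0 : 0 < t by rewrite divr_gt0.
have H (r s : R) (v' w' : 'rV[R]_n) : (v' = v /\ w' = w) \/ (v' = w /\ w' = v) ->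
    0 <= r <= t -> 0 <= s <= t -> `|x + r *: v' + s *: w' - x| < d.
  move=> vw /andP[r0 rt] /andP[s0 st].
  rewrite -[x + _ + _]addrA [x + _]addrC addrK.
  apply: (le_lt_trans (ler_normD _ _)); rewrite !normrZ !ger0_norm//.
  have dE : d = t * (`|v| + `|w|) + t.
    by rewrite -[t in X in _ + X]mulr1 -mulrDr /t divfK// gt_eqF.
  have Hv : r * `|v'| <= t * `|v'| by rewrite ler_wpM2r.
  have Hw : s * `|w'| <= t * `|w'| by rewrite ler_wpM2r.
  rewrite dE mulrDr; apply: (le_lt_trans (lerD Hv Hw)).
  by case: vw => -[-> ->]; [|rewrite [X in X < _]addrC]; rewrite ltrDl.
have [|r [s [rt st E]]] := @second_difference _ U f x v w t t0 f2.
  by move=> r s rt st; apply: (Hd _ (H _ _ _ _ _ rt st)).1; left.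
have [|r' [s' [rt' st' E']]] := @second_difference _ U f x w v t t0 f2.
  by move=> r' s' rt' st'; apply: (Hd _ (H _ _ _ _ _ rt' st')).1; right.
have [_ [H1 _]] := Hd _ (H _ _ _ _ (or_introl (conj erefl erefl)) rt st).
have [_ [_ H2]] := Hd _ (H _ _ _ _ (or_intror (conj erefl erefl)) rt' st').
(* The second difference is symmetric in [v] and [w], so the two mean values, taken at different
   points, coincide. *)
have EE : 'D_w ('D_v f) (x + r *: v + s *: w) =
    'D_v ('D_w f) (x + r' *: w + s' *: v).
  apply: (@mulIf _ (t * t)); first by rewrite gt_eqF// mulr_gt0.
  apply: etrans (esym E) _; apply: etrans _ E'.
  have -> : x + t *: w + t *: v = x + t *: v + t *: w by exact: addrAC.
  generalize (f (x + t *: v + t *: w)) (f (x + t *: v)) (f (x + t *: w)) (f x).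
  by move=> A B C D; ring.
apply: le_trans (ler_distD ('D_v ('D_w f) (x + r' *: w + s' *: v)) _ _) _.
by rewrite [leRHS]splitr; apply: lerD H2 _; rewrite -EE distrC.
Qed.

End MeanValue.

(** * Inverse function theorem *)

Section InverseFunction.
Context {R : realType} {n : nat}.
Implicit Types (x y v : 'rV[R]_n) (W : set 'rV[R]_n).

Lemma mx_entry_le_norm {p q} (M : 'M[R]_(p, q)) i j : `|M i j| <= `|M|.
Proof. by rewrite [leRHS]/Num.Def.normr /= mx_normrE; exact: (le_bigmax _ _ (i, j)). Qed.

Lemma mx_norm_le {p q} (M : 'M[R]_(p, q)) (c : R) :
  0 <= c -> (forall i j, `|M i j| <= c) -> `|M| <= c.
Proof.
by move=> c0 H; rewrite [leLHS]/Num.Def.normr /= mx_normrE bigmax_le// => -[i j] _.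
Qed.

(** The finitely many partial derivatives are continuous and vanish at [x0], so they are uniformly
    small on a ball; the ball is convex, and the mean value theorem along segments turns this into a
    Lipschitz bound. *)
Lemma small_differential_contracts W (r : 'rV[R]_n -> 'rV[R]_n) x0 (e : R) :
  open W -> W x0 -> Ck 1 W r -> (forall v, 'D_v r x0 = 0) -> 0 < e ->
  exists2 rho : R, 0 < rho & forall x, `|x - x0| < rho ->
    [/\ W x, forall v, `|'D_v r x| <= e * `|v| &
        forall y, `|y - x0| < rho -> `|r y - r x| <= e * `|y - x|].
Proof.
move=> oW Wx0 [dr Dr] r0 e0.
(* Summing over the [n] basis directions costs a factor [n]; the successor avoids a division by zero
   when [n = 0]. *)
pose e1 := e / n.+1%:R; have e10 : 0 < e1 by rewrite divr_gt0.
have D : \forall x \near x0, forall i : 'I_n, `|'D_(delta_mx 0 i) r x| <= e1.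
  apply: (@filter_forall _ _
    (fun i x => `|'D_(delta_mx 0 i) r x| <= e1) _ (nbhs_filter x0)) => i.
  have := near_dist_le (Dr (delta_mx 0 i) x0 Wx0) e10.
  by apply: filterS => x; rewrite r0 subr0.
have [rho rho0 H] := near_norm_lt (filterI (near_open oW Wx0) D).
have Dle x v : `|x - x0| < rho -> `|'D_v r x| <= e * `|v|.
  move=> /H[Wx Dx]; rewrite derive_delta; last exact: dr.
  apply: (le_trans (ler_norm_sum _ _ _)).
  apply: (@le_trans _ _ (\sum_(i < n) `|v| * e1)).
    apply: ler_sum => i _; rewrite normrZ ler_pM//; exact: mx_entry_le_norm.
  rewrite sumr_const card_ord -mulr_natr -mulrA [leRHS]mulrC ler_wpM2l//.
  by rewrite /e1 mulrAC ler_pdivrMr// ler_pM2l// ler_nat.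
exists rho => // x xr; split=> [|v|y yr]; [exact: (H _ xr).1|exact: Dle|].
(* The norm is the maximum of the entries, so the scalar mean value theorem can be used entry by
   entry, with an intermediate point depending on the entry. *)
apply: mx_norm_le => [|i j]; first by rewrite mulr_ge0// ltW.
have cvx t : 0 <= t <= 1 -> `|x + t *: (y - x) - x0| < rho.
  move=> /andP[t0 t1].
  have -> : x + t *: (y - x) - x0 = (1 - t) *: (x - x0) + t *: (y - x0).
    rewrite scalerBl scale1r !scalerBr; apply/rowP => k; rewrite !mxE; ring.
  apply: (le_lt_trans (ler_normD _ _)); rewrite !normrZ !ger0_norm ?subr_ge0//.
  have [->|tn0] := eqVneq t 0; first by rewrite mul0r addr0 subr0 mul1r.
  have tp : 0 < t by rewrite lt_neqAle eq_sym tn0.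
  have -> : rho = (1 - t) * rho + t * rho by ring.
  by rewrite ler_ltD ?ler_wpM2l ?subr_ge0 ?(ltW xr)// ltr_pM2l.
have [|t tt] := @segment_MVT R _ (fun z => r z i j) x (y - x) 1 ltr01.
  by move=> t tt; apply/diff_derivable/differentiable_entry/dr; exact: (H _ (cvx t tt)).1.
rewrite scale1r subrKC mulr1 !mxE => ->.
rewrite derive_entry; last exact/dr/(H _ (cvx t tt)).1.
exact: le_trans (mx_entry_le_norm _ _ _) (Dle _ _ (cvx t tt)).
Qed.

Lemma mulmxr_continuous {p q} (B : 'M[R]_(p, q)) :
  continuous (fun v : 'rV[R]_p => v *m B).
Proof.
move=> x; apply/differentiable_continuous/differentiable_mx => i j.
rewrite (_ : (fun _ => _) = \sum_k (fun v : 'rV[R]_p => v i k * B k j)).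
  apply: differentiable_sum => k; apply: differentiableM => //.
  exact: differentiable_coord.
by apply/funext => v; rewrite mxE fct_sumE.
Qed.

Lemma Ck_det {p} k (U : set 'rV[R]_n) (M : 'rV[R]_n -> 'M[R]_p) : open U ->
  (forall i j, Ck k U (fun x => M x i j)) -> Ck k U (fun x => \det (M x)).
Proof.
move=> oU CM; apply: Ck_sum => // s _; apply: CkM => //; first exact: Ck_cst.
by apply: Ck_prod.
Qed.

(** Cramer's rule: each entry of the inverse is a signed minor divided by the determinant. *)
Lemma Ck_invmx {p} k (U : set 'rV[R]_n) (M : 'rV[R]_n -> 'M[R]_p) : open U ->
  (forall x, U x -> M x \in unitmx) -> (forall i j, Ck k U (fun x => M x i j)) ->
  forall i j, Ck k U (fun x => invmx (M x) i j).
Proof.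
move=> oU uM CM i j.
apply: (eq_Ck oU _ (CkM oU (CkV oU _ (Ck_det oU CM)) (CkM oU
  (Ck_cst k U ((-1) ^+ (j + i) : R))
  (@Ck_det _ k U (fun x => row' j (col' i (M x))) oU _)))) => [x Ux|x Ux|a b].
- by rewrite /invmx uM// !mxE.
- by have := uM x Ux; rewrite unitmxE unitfE.
- by apply: (eq_Ck oU _ (CM (lift j a) (lift i b))) => x _; rewrite !mxE.
Qed.

(* The solution is the fixed point of [z |-> z + y - phi z]. *)
Lemma local_surjectivity (phi : 'rV[R]_n -> 'rV[R]_n) x (d : R) : 0 < d ->
  (forall z z' : 'rV[R]_n, `|z - x| <= d -> `|z' - x| <= d ->
     `|(z - phi z) - (z' - phi z')| <= 2^-1 * `|z - z'|) ->
  forall y, `|y - phi x| <= d / 2 -> exists2 z, `|z - x| <= d & phi z = y.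
Proof.
move=> d0 lip y yd.
pose B := [set z : 'rV[R]_n | `|z - x| <= d].
pose T (z : 'rV[R]_n) := z + y - phi z.
have xB : B x by rewrite /B/= subrr normr0 ltW.
have TB : {homo T : z / B z >-> B z}.
  move=> z Bz; have H := lip z x Bz xB.
  change (`|T z - x| <= d).
  have -> : T z - x = (y - phi x) + (z - phi z - (x - phi x)).
    by rewrite /T; apply/rowP => k; rewrite !mxE; ring.
  apply: (le_trans (ler_normD _ _)); rewrite [leRHS]splitr lerD//.
  by apply: (le_trans H); rewrite mulrC ler_pM2r ?invr_gt0.
have cB : closed B.
  have -> : B = closed_ball_ (fun z => `|z|) x d.
    by apply/funext => z; rewrite /B/closed_ball_ /= distrC.
  exact: closed_closed_ball_.
have [z Bz zT] : exists2 z, B z & z = T z.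
  pose f : {fun B >-> B} := [fun of mkfun TB].
  pose X : completeNormedModType R := HB.pack 'rV[R]_n (Complete.on 'rV[R]_n).
  apply: (@banach_fixed_point R X B f) => //; last by exists x.
  exists (2^-1)%:nng; split; first by rewrite /= invf_lt1// ltr1n.
  move=> [z z'] /= [Bz Bz'].
  have -> : T z - T z' = z - phi z - (z' - phi z').
    by rewrite /T; apply/rowP => k; rewrite !mxE; ring.
  exact: lip.
exists z => //; move/eqP: zT; rewrite /T -addrA -subr_eq0 opprD addrA subrr sub0r.
by rewrite oppr_eq0 subr_eq0 eq_sym => /eqP.
Qed.

(** Because the differential at [x0] is the identity, [r = id - phi] is Lipschitz with constant 1/2
    near [x0]. Hence distances shrink at most by half under [phi], which gives injectivity and a
    Lipschitz inverse, and [local_surjectivity] gives openness of the image. *)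
Lemma inverse_function W (phi : 'rV[R]_n -> 'rV[R]_n) x0 :
  open W -> W x0 -> smooth W phi -> (forall v, 'D_v phi x0 = v) ->
  exists N N', [/\ N x0, N `<=` W & is_diffeo N N' phi].
Proof.
move=> oW Wx0 sphi dphi0.
pose r (x : 'rV[R]_n) := x - phi x.
have dphi x : W x -> differentiable phi x by exact: (sphi 1%N).1.
have Dr v x : W x -> 'D_v r x = v - 'D_v phi x.
  move=> Wx; apply: etrans (deriveB _ _) _; [exact: derivable_id|exact/diff_derivable/dphi|].
  by rewrite derive_id.
have Cr : Ck 1 W r.
  split=> [x Wx|v]; first by apply: differentiableB => //; exact: dphi.
  apply: (@eq_Ck _ _ _ 0 W (fun x => v - 'D_v phi x)) => // [x Wx|x Wx].
    by rewrite Dr.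
  exact: cvgB (@cst_continuous _ _ v x) ((sphi 1%N).2 v x Wx).
have r0 v : 'D_v r x0 = 0 by rewrite Dr// dphi0 subrr.
have h0 : (0 : R) < 2^-1 by rewrite invr_gt0.
have [rho rho0 H] := small_differential_contracts oW Wx0 Cr r0 h0.
pose N := [set x : 'rV[R]_n | `|x - x0| < rho].
have NW : N `<=` W by move=> x /H[].
have lip x y : N x -> N y -> `|r y - r x| <= 2^-1 * `|y - x|.
  by move=> Nx Ny; have [_ _] := H x Nx; exact.
have expand x y : N x -> N y -> `|y - x| <= 2 * `|phi y - phi x|.
  move=> Nx Ny; have := lip x y Nx Ny.
  have -> : phi y - phi x = (y - x) - (r y - r x).
    by rewrite /r; apply/rowP => k; rewrite !mxE; ring.
  have := lerB_dist (y - x) (r y - r x); lra.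
have oN : open N.
  rewrite (_ : N = ball x0 rho); first exact: ball_open.
  by apply/funext => z; rewrite /N -ball_normE/ball_ /= distrC.
pose N' := phi @` N.
have oN' : open N'.
  rewrite openE => _ [x Nx <-].
  have [d d0 Hd] := near_norm_lt (near_open oN Nx).
  (* The first halving puts a closed ball inside the open set [N]; the second is the loss of radius
     in [local_surjectivity]. *)
  have d2 : 0 < d / 2 by rewrite divr_gt0.
  have d4 : 0 < d / 2 / 2 by rewrite divr_gt0.
  have Hd2 z : `|z - x| <= d / 2 -> N z.
    by move=> zx; apply: Hd; apply: (le_lt_trans zx); rewrite ltr_pdivrMr// ltr_pMr// ltr1n.
  change (nbhs (phi x) N'); apply: (@norm_lt_near _ _ (phi x) N' _ d4) => y yx.
  have [z z' zx zx'|z zx <-] := @local_surjectivity phi x (d / 2) d2 _ y (ltW yx).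
    by apply: lip; exact: Hd2.
  by exists z => //; exact: Hd2.
(* The default [x0] is the value outside [N'], where nothing is claimed about [psi]. *)
pose psi y := xget x0 [set x | N x /\ phi x = y].
have psiP y : N' y -> N (psi y) /\ phi (psi y) = y.
  by move=> [x Nx xy]; apply: (@xgetPex _ x0 [set x | N x /\ phi x = y]); exists x.
have psiK x : N x -> psi (phi x) = x.
  move=> Nx; have [Np pE] : N (psi (phi x)) /\ phi (psi (phi x)) = phi x.
    by apply: psiP; exists x.
  apply/eqP; rewrite -subr_eq0 -normr_le0.
  by apply: (le_trans (expand _ _ Nx Np)); rewrite pE subrr normr0 mulr0.
pose J x := jacobian phi x.
have JE v x : W x -> 'D_v phi x = v *m J x.
  by move=> Wx; rewrite deriveEjacobian//; exact: dphi.
(* If [v *m J x = 0] then ['D_v r x = v], while the contraction bound gives a norm of at most half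
   that of [v]; so [v = 0]. *)
have Ju x : N x -> J x \in unitmx.
  move=> Nx; rewrite -row_free_unit; apply: inj_row_free => v vJ.
  have [_ Hv _] := H x Nx; have := Hv v; rewrite Dr ?JE ?vJ ?subr0; [|exact: NW..].
  have := normr_ge0 v => v0 v1; apply/eqP; rewrite -normr_eq0; apply/eqP; lra.
have dpsi y : N' y -> is_diff y psi (mulmxr (invmx (J (psi y)))).
  move=> N'y; have [Nx xE] := psiP y N'y; set x := psi y in Nx xE *.
  have cB : continuous (mulmxr (invmx (J x)) : 'rV[R]_n -> 'rV[R]_n).
    exact: mulmxr_continuous.
  apply: (diff_normP psi y cB).1 => e e0.
  have [kB kB0 HB] := linear_lipschitz cB.
  (* [kB] is a Lipschitz constant of the inverse Jacobian and 2 is that of [psi]; their product is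
     absorbed here. *)
  have e1 : 0 < e / (2 * kB) by rewrite divr_gt0// mulr_gt0.
  have dx := dphi x (NW _ Nx).
  have [d d0 Hd] := near_norm_lt
    ((diff_normP phi x (diff_continuous dx)).2 (differentiableP dx) _ e1).
  have [d' d'0 Hd'] := near_norm_lt (near_open oN' N'y).
  have dd0 : 0 < Num.min d' (d / 2) by rewrite lt_min d'0 divr_gt0.
  apply: (@norm_lt_near _ _ y _ _ dd0) => y'; rewrite lt_min => /andP[yd' yd].
  have [Nx' xE'] := psiP y' (Hd' _ yd'); set x' := psi y' in Nx' xE' *.
  have xx := expand x x' Nx Nx'; rewrite xE xE' in xx.
  have xd : `|x' - x| < d by apply: (le_lt_trans xx); rewrite mulrC -ltr_pdivlMr.
  have := Hd _ xd; rewrite xE xE' -deriveE// JE; last exact: NW.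
  move=> E; have := HB (y' - y - (x' - x) *m J x); rewrite /= mulmxBl.
  rewrite mulmxK; last exact: Ju.
  rewrite -normrN opprB => E'; apply: (le_trans E').
  apply: (le_trans (ler_wpM2l (ltW kB0) E)).
  have -> : kB * (e / (2 * kB) * `|x' - x|) = e * (2^-1 * `|x' - x|).
    by field; rewrite gt_eqF.
  by apply: ler_wpM2l; [exact: ltW|rewrite ler_pdivrMl].
exists N, N'; split => //; first by rewrite /N/= subrr normr0.
split => //; first by move=> k; exact: Ck_sub NW (sphi k).
exists psi => // k.
(* Bootstrapping: the derivative of [psi] is the inverse Jacobian of [phi] composed with [psi],
   which is of class C^k as soon as [psi] is. *)
elim: k => [|k IH].
  by move=> y N'y; apply: differentiable_continuous; have [] := dpsi y N'y.
split=> [y N'y|v]; first by have [] := dpsi y N'y.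
apply/(Ck_mxP _ _ oN') => i j.
apply: (@eq_Ck _ _ _ k N' ((fun x => \sum_l v 0 l * invmx (J x) l j) \o psi)) => //.
  move=> y N'y; have [dy dE] := dpsi y N'y.
  by rewrite deriveE// dE/= mxE ord1.
apply: (Ck_comp (U := N)) => //; first by move=> y /psiP[].
apply: Ck_sum => // l _; apply: CkM => //; first exact: Ck_cst.
apply: Ck_invmx => // a b.
apply: (@eq_Ck _ _ _ k N (fun x => 'D_(delta_mx 0 a) phi x 0 b)) => //.
  by move=> x /NW Wx; rewrite JE// -rowE mxE.
apply: ((Ck_mxP _ _ oN).1 _ 0 b).
exact: Ck_sub NW ((sphi k.+1).2 _).
Qed.

End InverseFunction.

(** * Poincare lemma *)

Section Poincare.
Context {R : realType} {n : nat}.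
Implicit Types (x y v : 'rV[R]_n) (W : set 'rV[R]_n) (th : one_form R n).

Lemma evE th y v : ev th y v = \sum_i v 0 i * th y i 0.
Proof. by rewrite /ev mxE. Qed.

Lemma ev_is_linear th y : linear (ev th y).
Proof. by move=> k u v; rewrite /ev mulmxDl -scalemxAl !mxE. Qed.

HB.instance Definition _ th y :=
  GRing.isLinear.Build R 'rV[R]_n R _ (ev th y) (ev_is_linear th y).

Lemma ev_continuous th y : continuous (ev th y).
Proof.
by move=> v; exact: continuous_comp (@mulmxr_continuous _ _ _ (th y) v)
  (@coord_continuous _ _ _ 0 0 (v *m th y)).
Qed.

Lemma Ck_ev k U th v : open U -> Ck k U th -> Ck k U (fun y => ev th y v).
Proof.
move=> oU Cth; apply: (@eq_Ck _ _ _ k U (fun y => \sum_i v 0 i * th y i 0)) => //.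
  by move=> y _; rewrite evE.
apply: Ck_sum => // i _; apply: CkM => //; first exact: Ck_cst.
exact: (Ck_mxP _ _ oU).1.
Qed.

Lemma mulmx_norm_le v (M : 'cV[R]_n) : `|(v *m M) 0 0| <= n%:R * (`|v| * `|M|).
Proof.
rewrite mxE; apply: (le_trans (ler_norm_sum _ _ _)).
apply: (@le_trans _ _ (\sum_(i < n) `|v| * `|M|)).
  by apply: ler_sum => i _; rewrite normrM ler_pM//; exact: mx_entry_le_norm.
by rewrite sumr_const card_ord mulr_natl lexx.
Qed.

(** On the segment from [x] to [y] the mean value theorem writes the increment of [h] as [th] at an
    intermediate point applied to [y - x]. Continuity of [th] at [x] makes the difference with
    [ev th x] small relative to the norm of [y - x]. *)
Lemma differentiable_of_derive W (h : 'rV[R]_n -> R) th x :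
  open W -> W x -> {for x, continuous th} ->
  (forall y v, W y -> derivable h y v /\ 'D_v h y = ev th y v) ->
  differentiable h x.
Proof.
move=> oW Wx cth dh; suff [dhx _] : is_diff x h (ev th x) by exact: dhx.
apply: (diff_normP h x (@ev_continuous th x)).1 => e e0.
have e1 : 0 < e / n.+1%:R by rewrite divr_gt0.
have [d d0 Hd] := near_norm_lt (filterI (near_open oW Wx) (near_dist_le cth e1)).
apply: (norm_lt_near d0) => y yd.
have seg t : 0 <= t <= 1 -> `|x + t *: (y - x) - x| < d.
  move=> /andP[t0 t1]; rewrite addrAC subrr add0r normrZ ger0_norm//.
  by apply: le_lt_trans yd; rewrite ler_piMl.
have [|t tt] := @segment_MVT R _ h x (y - x) 1 ltr01.
  by move=> t tt; exact: (dh _ _ (Hd _ (seg t tt)).1).1.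
rewrite scale1r subrKC mulr1 => ->.
rewrite (dh _ _ (Hd _ (seg t tt)).1).2 /= /ev.
rewrite -[X in `|X|]/(((y - x) *m th (x + t *: (y - x))) 0 0 -
  ((y - x) *m th x) 0 0).
have -> : ((y - x) *m th (x + t *: (y - x))) 0 0 - ((y - x) *m th x) 0 0 =
    ((y - x) *m (th (x + t *: (y - x)) - th x)) 0 0 by rewrite mulmxBr !mxE.
apply: (le_trans (mulmx_norm_le _ _)).
have := (Hd _ (seg t tt)).2 => E.
apply: (@le_trans _ _ (n%:R * (`|y - x| * (e / n.+1%:R)))).
  by rewrite ler_wpM2l// ler_wpM2l.
rewrite mulrCA [leRHS]mulrC ler_wpM2l// mulrA ler_pdivrMr//.
by rewrite mulrC ler_pM2l// ler_nat.
Qed.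

Let mu := @lebesgue_measure R.

Lemma integral01_derive (F f : R -> R) :
  (forall t : R, 0 <= t <= 1 -> is_derive t 1 F (f t)) ->
  (forall t : R, 0 <= t <= 1 -> derivable f t 1) ->
  \int[mu]_(t in `[0, 1]) f t = F 1 - F 0.
Proof.
move=> dF df.
have cF t : 0 <= t <= 1 -> {for t, continuous F}.
  move=> t01; apply: differentiable_continuous; apply/derivable1_diffP.
  by have [] := dF t t01.
rewrite /Rintegral (@continuous_FTC2 _ _ F)//.
- by apply: derivable_within_continuous => t; rewrite in_itv/=; exact: df.
- split.
  + move=> t; rewrite in_itv/= => /andP[t0 t1].
    by have [] := dF t _; rewrite ?ltW.
  + by apply: cvg_at_right_filter; apply: cF; rewrite lexx ler01.
  + by apply: cvg_at_left_filter; apply: cF; rewrite lexx ler01.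
- move=> t; rewrite in_itv/= => /andP[t0 t1].
  by rewrite derive1E; have [] := dF t _; rewrite ?ltW.
Qed.

(** The constant [M] is an integrable dominating function on [[0, 1]], so the derivative passes
    under the integral; derivability of [g r] in [t] provides the integrability of the integrand. *)
Lemma derive_integral01 (g dg : R -> R -> R) (d M : R) : 0 < d ->
  (forall r t : R, `|r| < d -> 0 <= t <= 1 -> is_derive r 1 (g^~ t) (dg r t)) ->
  (forall r t : R, `|r| < d -> 0 <= t <= 1 -> `|dg r t| <= M) ->
  (forall r t : R, `|r| < d -> 0 <= t <= 1 -> derivable (g r) t 1) ->
  is_derive (0 : R) 1 (fun r : R => \int[mu]_(t in `[0, 1]) g r t)
    (\int[mu]_(t in `[0, 1]) dg 0 t).
Proof.
move=> d0 Dg dgM dg1.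
have M0 : 0 <= M.
  by apply: le_trans (normr_ge0 (dg 0 0)) (dgM 0 0 _ _); rewrite ?normr0 ?lexx ?ler01.
have I0 : `]- d, d[%classic (0 : R) by rewrite /= in_itv/= oppr_lt0 d0.
have itvE (r : R) : `]- d, d[%classic r -> `|r| < d.
  by rewrite /= in_itv/= ltr_norml.
have mI : measurable (`[0, 1]%classic : set (measurableTypeR R)) by exact: measurable_itv.
have intg r : `]- d, d[%classic r -> mu.-integrable `[0, 1] (EFin \o g r).
  move=> /itvE rd; apply: continuous_compact_integrable; first exact: segment_compact.
  by apply: derivable_within_continuous => t; rewrite in_itv/=; exact: dg1.
have dg' r t : `]- d, d[%classic r -> `[0, 1]%classic t -> derivable (g^~ t) r 1.
  by move=> /itvE rd; rewrite /= in_itv/= => t01; have [] := Dg r t rd t01.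
have E r t : `]- d, d[%classic r -> `[0, 1]%classic t -> partial1of2 g r t = dg r t.
  move=> /itvE rd; rewrite /= in_itv/= => t01.
  by rewrite partial1of2E; have [] := Dg r t rd t01.
have intM : mu.-integrable `[0, 1] (EFin \o (fun _ : R => M)).
  apply: continuous_compact_integrable; first exact: segment_compact.
  by apply: continuous_subspaceT; exact: cst_continuous.
have ub r t : `]- d, d[%classic r -> `[0, 1]%classic t -> `|partial1of2 g r t| <= M.
  by move=> rd t01; rewrite E//; apply: dgM; [exact: itvE|move: t01; rewrite /= in_itv].
apply: DeriveDef.
  exact: (derivable_under_integral mI I0 intg dg' (fun _ => M0) intM ub).
rewrite -derive1E (differentiation_under_integral mI I0 intg dg' (fun _ => M0) intM ub).
by apply: eq_Rintegral => t; rewrite inE => t01; rewrite E.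
Qed.

Lemma is_derive_ev th p u v : differentiable th p ->
  is_derive p u (fun q => ev th q v) ((v *m 'D_u th p) 0 0).
Proof.
move=> dth.
have D : is_derive p u (\sum_i (fun q => v 0 i * th q i 0))
   (\sum_i v 0 i * 'D_u th p i 0).
  apply: is_derive_sum => i.
  have [h1 h2] : is_derive p u (fun q => th q i 0) ('D_u th p i 0).
    apply: DeriveDef; last exact: derive_entry.
    exact/diff_derivable/differentiable_entry.
  by apply: DeriveDef; [exact: derivableZ|rewrite deriveZ// h2].
rewrite mxE (_ : (fun q => ev th q v) = \sum_i (fun q => v 0 i * th q i 0))//.
by apply/funext => q; rewrite evE fct_sumE.
Qed.

(** Derivative of the integrand of the radial primitive: the first term comes from the argument
    [y - x0], the second from the moving base point, which contributes the factor [t]. *)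
Lemma is_derive_radial th x0 y v (t : R) :
  let p := x0 + t *: (y - x0) in differentiable th p ->
  is_derive y v (fun y => ev th (x0 + t *: (y - x0)) (y - x0))
    (ev th p v + t * 'D_v (fun q => ev th q (y - x0)) p).
Proof.
move=> p dth; have [_ ->] := is_derive_ev v (y - x0) dth.
pose sh (z : 'rV[R]_n) := x0 + t *: (z - x0).
have dsub z : is_derive z v (fun z => z - x0) v.
  by apply: is_derive_eq; rewrite subr0.
have dsub' z : differentiable (fun z => z - x0) z.
  by apply: differentiableB.
have dsh : differentiable sh y.
  by apply: differentiableD => //; apply: differentiableZ; exact: dsub'.
have Dsh : 'D_v sh y = t *: v.
  have [_ E] : is_derive y v (cst x0 + (fun z => t *: (z - x0))) (0 + t *: v).
    by apply: is_deriveD; exact: is_deriveZ.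
  exact: etrans E (add0r _).
have D : is_derive y v (\sum_i (fun z => (z - x0) 0 i * th (sh z) i 0))
   (\sum_i ((y - x0) 0 i * (t * 'D_v th p i 0) + th p i 0 * v 0 i)).
  apply: is_derive_sum => i.
  have h1 : is_derive y v (fun z => (z - x0) 0 i) (v 0 i).
    apply: DeriveDef; first exact/diff_derivable/differentiable_entry.
    by rewrite derive_entry//; have [_ ->] := dsub y.
  have h2 : is_derive y v (fun z => th (sh z) i 0) (t * 'D_v th p i 0).
    have dc : differentiable (th \o sh) y by exact: differentiable_comp.
    apply: DeriveDef; first exact/diff_derivable/(differentiable_entry i 0 dc).
    rewrite (derive_entry _ i 0 dc) derive_comp// Dsh.
    by rewrite !deriveE// linearZ mxE.
  exact: is_deriveM.
rewrite (_ : (fun y => _) = \sum_i (fun z => (z - x0) 0 i * th (sh z) i 0)); last first.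
  by apply/funext => z; rewrite evE fct_sumE.
rewrite (_ : _ + _ = \sum_i ((y - x0) 0 i * (t * 'D_v th p i 0) + th p i 0 * v 0 i))//.
rewrite big_split/= addrC; congr (_ + _).
  by rewrite evE; apply: eq_bigr => i _; rewrite mulrC.
by rewrite mxE mulr_sumr; apply: eq_bigr => i _; rewrite mulrCA.
Qed.

(** The primitive [h] is the integral of [th] along the ray from [x0], on a ball where [th] and its
    partial derivatives are bounded, as differentiation under the integral requires. *)
Lemma poincare W th x0 : open W -> W x0 -> Ck 2 W th ->
  (forall x v w, W x -> ext_d th x v w = 0) ->
  exists N h, [/\ open N, N x0, N `<=` W &
    forall x, N x -> differentiable h x /\ forall v, 'D_v h x = ev th x v].
Proof.
move=> oW Wx0 sth cl; have [dth Dth] := sth.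
(* [C] exceeds by at least 1 the norms at [x0] of [th] and of each partial derivative, so by
   continuity it bounds all of them nearby. *)
pose C := `|th x0| + 1 + \sum_(i < n) (`|'D_(delta_mx 0 i) th x0| + 1).
have s0 : 0 <= \sum_(i < n) (`|'D_(delta_mx 0 i) th x0| + 1).
  by apply: sumr_ge0 => i _; rewrite addr_ge0.
have C0 : 0 <= C by rewrite addr_ge0// addr_ge0.
have near_bound (f : 'rV[R]_n -> 'cV[R]_n) (c : R) : {for x0, continuous f} ->
    `|f x0| + 1 <= c -> \forall y \near x0, `|f y| <= c.
  move=> cf fc; have := near_dist_le cf ltr01; apply: filterS => y yf.
  apply: le_trans fc; rewrite -[f y](subrK (f x0)) addrC.
  exact: (le_trans (ler_normD _ _)) (lerD _ yf).
have B1 : \forall y \near x0, `|th y| <= C.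
  by apply: near_bound; [exact/differentiable_continuous/dth|rewrite lerDl].
have B2 : \forall y \near x0, forall i : 'I_n, `|'D_(delta_mx 0 i) th y| <= C.
  apply: (@filter_forall _ _
    (fun i y => `|'D_(delta_mx 0 i) th y| <= C) _ (nbhs_filter x0)) => i.
  apply: near_bound.
    exact/differentiable_continuous/(Dth (delta_mx 0 i)).1.
  rewrite /C (bigD1 i)//= [leRHS]addrCA lerDl addr_ge0 ?addr_ge0//.
  by apply: sumr_ge0 => j _; rewrite addr_ge0.
have [rho rho0 H] := near_norm_lt (filterI (near_open oW Wx0) (filterI B1 B2)).
pose N := [set x : 'rV[R]_n | `|x - x0| < rho].
have NW : N `<=` W by move=> x /H[].
have oN : open N.
  rewrite (_ : N = ball x0 rho); first exact: ball_open.
  by apply/funext => z; rewrite /N -ball_normE/ball_ /= distrC.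
have Nx0 : N x0 by rewrite /N/= subrr normr0.
have ray y (t : R) : N y -> 0 <= t <= 1 -> N (x0 + t *: (y - x0)).
  move=> Ny /andP[t0 t1]; rewrite /N/= addrAC subrr add0r normrZ ger0_norm//.
  by apply: le_lt_trans Ny; rewrite ler_piMl.
(* The second term uses closedness; as a function of [t] on the ray to [y], [dG y v]
   is the derivative of [t * ev th (x0 + t *: (y - x0)) v]. *)
pose dG y v (t : R) := ev th (x0 + t *: (y - x0)) v +
   t * 'D_(y - x0) (fun q => ev th q v) (x0 + t *: (y - x0)).
have DG y v t : N y -> 0 <= t <= 1 ->
    is_derive y v (fun y => ev th (x0 + t *: (y - x0)) (y - x0)) (dG y v t).
  move=> Ny t01; have Wp := NW _ (ray y t Ny t01).
  have := @is_derive_radial th x0 y v t (dth _ Wp).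
  by have /eqP := cl _ v (y - x0) Wp; rewrite subr_eq0 => /eqP ->.
have dGM y v t : N y -> 0 <= t <= 1 ->
    `|dG y v t| <= n%:R * (`|v| * C) + n%:R * (`|v| * (n%:R * (rho * C))).
  move=> Ny t01; have Np := ray y t Ny t01.
  have [Wp [b1 b2]] := H _ Np; set p := x0 + _ in Np Wp b1 b2 *.
  have dp := dth _ Wp.
  rewrite /dG; have [_ ->] := is_derive_ev (y - x0) v dp.
  apply: (le_trans (ler_normD _ _)); apply: lerD.
    apply: (le_trans (mulmx_norm_le _ _)).
    by rewrite ler_wpM2l// ler_wpM2l.
  have /andP[t0 t1] := t01; rewrite normrM ger0_norm//.
  apply: (@le_trans _ _ `|(v *m 'D_(y - x0) th p) 0 0|); first by rewrite ler_piMl.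
  apply: (le_trans (mulmx_norm_le _ _)); rewrite ler_wpM2l// ler_wpM2l//.
  rewrite derive_delta//; apply: (le_trans (ler_norm_sum _ _ _)).
  apply: (@le_trans _ _ (\sum_(i < n) rho * C)).
    apply: ler_sum => i _; rewrite normrZ ler_pM//.
    exact: le_trans (mx_entry_le_norm _ _ _) (ltW Ny).
  by rewrite sumr_const card_ord mulr_natl lexx.
pose h y := \int[mu]_(t in `[0, 1]) ev th (x0 + t *: (y - x0)) (y - x0).
have dline y w (t : R) : N y -> 0 <= t <= 1 ->
    derivable (fun t : R => ev th (x0 + t *: (y - x0)) w) t 1.
  move=> Ny t01.
  have [D1 _] := is_derive_ev (y - x0) w (dth _ (NW _ (ray y t Ny t01))).
  by have [] := is_derive_line D1.
have dh x v : N x -> derivable h x v /\ 'D_v h x = ev th x v.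
  move=> Nx.
  (* The directional derivative is computed as a derivative in the real parameter [r] at 0, for
     which [x + r *: v] has to remain in the ball. *)
  have [d d0 Hd] : exists2 d : R, 0 < d & forall r : R, `|r| < d -> N (x + r *: v).
    have [e e0 He] := near_norm_lt (near_open oN Nx).
    have v1 : 0 < `|v| + 1 by rewrite ltr_wpDl.
    exists (e / (`|v| + 1)); first by rewrite divr_gt0.
    move=> r; rewrite ltr_pdivlMr// => rv; apply: He.
    rewrite addrAC subrr add0r normrZ; apply: le_lt_trans rv.
    by rewrite ler_wpM2l// lerDl.
  have D : is_derive (0 : R) 1 (fun r : R => h (x + r *: v))
      (\int[mu]_(t in `[0, 1]) dG (x + (0 : R) *: v) v t).
    apply: (@derive_integral01
      (fun r t => ev th (x0 + t *: (x + r *: v - x0)) (x + r *: v - x0))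
      (fun r t => dG (x + r *: v) v t) d
      (n%:R * (`|v| * C) + n%:R * (`|v| * (n%:R * (rho * C))))) => //.
    - move=> r t /Hd Nr t01; have [G1 G2] := DG _ v t Nr t01.
      by have := is_derive_line G1; rewrite G2.
    - by move=> r t /Hd Nr; exact: dGM.
    - by move=> r t /Hd Nr; exact: dline.
  have I : \int[mu]_(t in `[0, 1]) dG (x + (0 : R) *: v) v t = ev th x v.
    rewrite scale0r addr0.
    apply: etrans (@integral01_derive
      (fun t => t * ev th (x0 + t *: (x - x0)) v) _ _ _) _.
    - move=> t t01.
      have := @is_derive_line _ _ _ (fun q => ev th q v) x0 (x - x0) t.
      have [e1 e2] := is_derive_ev (x - x0) v (dth _ (NW _ (ray x t Nx t01))).
      move=> /(_ e1) K; have [k1 k2] := is_deriveM (is_derive_id t 1) K.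
      apply: DeriveDef; first exact: k1.
      by apply: etrans k2 _; rewrite /dG addrC; congr (_ + _); exact: mulr1.
    - move=> t t01; apply: derivableD; first exact: dline.
      apply: derivableM => //.
      have Cv := (Ck_ev v oW sth).2 (x - x0).
      have dv := @diff_derivable _ _ _ _ _ (x - x0) (Cv.1 _ (NW _ (ray x t Nx t01))).
      by have [] := is_derive_line dv.
    - by rewrite mul0r subr0 mul1r scale1r subrKC.
  have Dh : is_derive x v h (ev th x v).
    have E : (fun k : R => k^-1 *: (((fun r => h (x + r *: v)) \o shift 0) (k *: 1)
          - h (x + (0 : R) *: v)))
        = (fun k => k^-1 *: ((h \o shift x) (k *: v) - h x)).
      by apply/funext => k; rewrite /= scale0r !addr0 [k%:A]mulr1 (addrC x).
    move: D; rewrite I => -[]; rewrite /derivable /derive E => D1 D2.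
    exact: DeriveDef.
  by have [] := Dh.
exists N, h; split => // x Nx; split; last by move=> v; have [] := dh x v Nx.
apply: (@differentiable_of_derive N h th) => //.
  exact/differentiable_continuous/dth/NW.
Qed.

End Poincare.

(** * Hexagonal plane webs *)

Section PlaneWebs.
Context {R : realType}.
Implicit Types (s t v w : 'rV[R]_2) (W N : set 'rV[R]_2) (th ga : one_form R 2).

Let d0 : 'rV[R]_2 := delta_mx 0 0.
Let d1 : 'rV[R]_2 := delta_mx 0 1.

Lemma Ck_expR {n} k (U : set 'rV[R]_n) (h : 'rV[R]_n -> R) : open U ->
  Ck k U h -> Ck k U (fun x => expR (h x)).
Proof.
move=> oU; elim: k => [|k IH] hS.
  by move=> x Ux; exact: continuous_comp (hS x Ux) (@continuous_expR R (h x)).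
have [dh Dh] := hS; have dexp (r : R) : differentiable (@expR R) r.
  exact/derivable1_diffP/derivable_expR.
split=> [x Ux|v]; first by apply: differentiable_comp; [exact: dh|].
apply: (eq_Ck oU _ (CkM oU (Dh v) (IH (CkW hS)))) => x Ux.
apply: esym; apply: etrans (derive_comp v (dh x Ux) (dexp (h x))) _.
rewrite deriveE// -[X in 'd _ _ X]mulr1 linearZ/= -deriveE//.
by have [_ ->] := is_derive_expR (h x).
Qed.

Lemma smooth_primitive {n} (U : set 'rV[R]_n) (h : 'rV[R]_n -> R) (th : one_form R n) :
  open U -> smooth U th ->
  (forall x, U x -> differentiable h x /\ forall v : 'rV[R]_n, 'D_v h x = ev th x v) ->
  smooth U h.
Proof.
move=> oU sth dh; have Sk k : Ck k.+1 U h.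
  split=> [x /dh[]//|v].
  by apply: (eq_Ck oU _ (Ck_ev v oU (sth k))) => x /dh[_ ->].
by move=> k; exact/CkW/Sk.
Qed.

(** The two equations say that the covector [z] is parallel to [x] and to [y], which are
    independent. Below, this is how [theta /\ kappa = 0] for two independent [theta] forces
    [kappa = 0]. *)
Lemma plane_proportional (x0 x1 y0 y1 z0 z1 : R) : x0 * y1 - x1 * y0 != 0 ->
  z0 * x1 = z1 * x0 -> z0 * y1 = z1 * y0 -> z0 = 0 /\ z1 = 0.
Proof.
move=> O zx zy; split; apply: (mulIf O); rewrite mul0r mulrBr.
  by rewrite mulrCA zy mulrA [z0 * _]mulrA zx; ring.
by rewrite !mulrA -zx; rewrite [z1 * x1 * y0]mulrAC -zy; ring.
Qed.

Lemma sum2 {V : nmodType} (F : 'I_2 -> V) : \sum_i F i = F 0 + F 1.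
Proof.
by rewrite !big_ord_recl big_ord0 addr0; congr (F _ + F _); apply: val_inj.
Qed.

Definition cross (u v : 'rV[R]_2) : R := u 0 0 * v 0 1 - u 0 1 * v 0 0.

Lemma row2P (u v : 'rV[R]_2) : u 0 0 = v 0 0 -> u 0 1 = v 0 1 -> u = v.
Proof.
move=> E0 E1; apply/rowP => -[[|[|i]] Hi] //.
  by rewrite (_ : Ordinal Hi = 0) ?E0//; apply: val_inj.
by rewrite (_ : Ordinal Hi = 1) ?E1//; apply: val_inj.
Qed.

Lemma row_free_cross (u v : 'rV[R]_2) : row_free (col_mx u v) = (cross u v != 0).
Proof.
apply/idP/idP => [fr|c0].
  apply/eqP => c0.
  have ind (a b : R) : a *: u + b *: v = 0 -> a = 0 /\ b = 0.
    rewrite -!mul_scalar_mx -mul_row_col => E.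
    have := row_free_inj fr (etrans E (esym (mul0mx _ _))).
    rewrite -row_mx0 => /eq_row_mx[/matrixP/(_ 0 0) + /matrixP/(_ 0 0)].
    by rewrite !mxE !mulr1n.
  have [v1 u1] : v 0 1 = 0 /\ - u 0 1 = 0.
    by apply: ind; apply: row2P; rewrite !mxE; move: c0; rewrite /cross; lra.
  have [v0 u0] : v 0 0 = 0 /\ - u 0 0 = 0.
    by apply: ind; apply: row2P; rewrite !mxE; move: c0; rewrite /cross; lra.
  have [/eqP] : (1 : R) = 0 /\ (0 : R) = 0.
    apply: ind; rewrite scale0r addr0 scale1r.
    by apply: row2P; rewrite mxE; lra.
  by rewrite oner_eq0.
apply: inj_row_free => w; rewrite -[w]hsubmxK mul_row_col => E.
rewrite [lsubmx w]mx11_scalar [rsubmx w]mx11_scalar in E *.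
move: (lsubmx w 0 0) (rsubmx w 0 0) E => a b; rewrite !mul_scalar_mx => /rowP E.
have := E 0; have := E 1; rewrite !mxE => E1 E0.
have a0 : a = 0.
  apply: (mulIf c0); rewrite mul0r /cross.
  have -> : a * (u 0 0 * v 0 1 - u 0 1 * v 0 0) =
    (a * u 0 0 + b * v 0 0) * v 0 1 - (a * u 0 1 + b * v 0 1) * v 0 0 by ring.
  by rewrite E0 E1 !mul0r subrr.
have b0 : b = 0.
  apply: (mulIf c0); rewrite mul0r /cross.
  have -> : b * (u 0 0 * v 0 1 - u 0 1 * v 0 0) =
    (a * u 0 1 + b * v 0 1) * u 0 0 - (a * u 0 0 + b * v 0 0) * u 0 1 by ring.
  by rewrite E0 E1 !mul0r subrr.
by rewrite a0 b0 raddf0 row_mx0.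
Qed.

(** The vector [v] certifies that [u] is nonzero and supplies the coefficient of [z] along [u]. *)
Lemma submx_cross (z u v : 'rV[R]_2) : cross u v != 0 ->
  (z <= u)%MS <-> cross z u = 0.
Proof.
move=> c0; split=> [/sub_rVP[k ->]|zu].
  by rewrite /cross !mxE; ring.
apply/sub_rVP; exists (cross z v / cross u v); move: zu c0; rewrite /cross => zu c0.
by apply: row2P; rewrite !mxE; apply: (mulIf c0); rewrite mulrAC divfK//;
   apply/eqP; rewrite -subr_eq0; apply/eqP;
   [apply: etrans (_ : - v 0 0 * (z 0 0 * u 0 1 - z 0 1 * u 0 0) = 0)
   |apply: etrans (_ : - v 0 1 * (z 0 0 * u 0 1 - z 0 1 * u 0 0) = 0)];
   [ring|rewrite zu mulr0|ring|rewrite zu mulr0].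
Qed.

Lemma crossD (u v w : 'rV[R]_2) (a b : R) :
  cross (a *: u + b *: v) w = a * cross u w + b * cross v w.
Proof. by rewrite /cross !mxE; ring. Qed.

Section Coframe.
Variables (W : set 'rV[R]_2) (th0 th1 ga : one_form R 2).
Hypotheses (oW : open W) (sth0 : smooth W th0) (sth1 : smooth W th1)
  (sga : smooth W ga).
Hypothesis nondeg : forall s v, W s -> ev th0 s v = 0 -> ev th1 s v = 0 -> v = 0.
Hypothesis dth0 : forall s v w, W s -> ext_d th0 s v w = wedge1 th0 ga s v w.
Hypothesis dth1 : forall s v w, W s -> ext_d th1 s v w = wedge1 th1 ga s v w.

Let Om s := ev th0 s d0 * ev th1 s d1 - ev th0 s d1 * ev th1 s d0.

(** [Om] is the coefficient of [th0 /\ th1]. If it vanishes, the vector built from the coefficients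
    of [th0] that [th0] always kills is killed by [th1] too, so these coefficients are zero; the
    same holds for [th1], and then [d0] itself is killed by both forms. *)
Lemma wedge_frame_neq0 s : W s -> Om s != 0.
Proof.
move=> Ws; apply/eqP => O.
have lin (a b : R) th : ev th s (a *: d0 - b *: d1) = a * ev th s d0 - b * ev th s d1.
  by rewrite linearB !linearZ.
have d00 (a b : R) : a *: d0 - b *: d1 = 0 -> a = 0 /\ b = 0.
  move=> /rowP E; have := E 0; have := E 1; rewrite !mxE/=.
  by split; lra.
have [|z1 z0] := @d00 (ev th0 s d1) (ev th0 s d0).
  apply: (nondeg Ws); rewrite lin; first by rewrite mulrC subrr.
  by move: O; rewrite /Om; lra.
have [|z3 z2] := @d00 (ev th1 s d1) (ev th1 s d0).
  apply: (nondeg Ws); rewrite lin; last by rewrite mulrC subrr.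
  by rewrite z0 z1; lra.
have : d0 = 0 by apply: (nondeg Ws).
by move/rowP/(_ 0); rewrite !mxE/= => /eqP; rewrite oner_eq0.
Qed.

(* The hypotheses force [df0 = g th0] and [df1 = g th1] with the same factor [g]. *)
Lemma closed_of_exact_annihilators N (f0 f1 : 'rV[R]_2 -> R) :
  open N -> N `<=` W -> smooth N f0 -> smooth N f1 ->
  (forall t w, N t -> ev th0 t w = 0 <-> 'D_w f0 t = 0) ->
  (forall t w, N t -> ev th1 t w = 0 -> 'D_w f1 t = 0) ->
  (forall t w, N t -> ev th0 t w + ev th1 t w = 0 -> 'D_w f0 t + 'D_w f1 t = 0) ->
  forall t v w, N t -> ext_d ga t v w = 0.
Proof.
move=> oN NW sf0 sf1 H0 H1 H2.
have swap (f : 'rV[R]_2 -> R) t v w : smooth N f -> N t -> 'D_v ('D_w f) t = 'D_w ('D_v f) t.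
  by move=> sf Nt; exact: (derive_swap v w oN (sf 2%N) Nt).
have Dlin (f : 'rV[R]_2 -> R) t v : smooth N f -> N t ->
    'D_v f t = v 0 0 * 'D_d0 f t + v 0 1 * 'D_d1 f t.
  by move=> sf Nt; rewrite (derive_delta v ((sf 1%N).1 t Nt)) sum2.
have evlin th t v : ev th t v = v 0 0 * ev th t d0 + v 0 1 * ev th t d1.
  have vE : v = v 0 0 *: d0 + v 0 1 *: d1 by rewrite [LHS]row_sum_delta sum2.
  by rewrite {1}vE linearD !linearZ.
have Dmul (F A B : 'rV[R]_2 -> R) t v : smooth N A -> smooth N B -> N t ->
    (forall s, N s -> F s = A s * B s) ->
    'D_v F t = A t * 'D_v B t + B t * 'D_v A t.
  move=> sA sB Nt FE; have -> : 'D_v F t = 'D_v (fun s => A s * B s) t.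
    by apply: near_eq_derive; have := near_open oN Nt; apply: filterS => s /FE.
  by apply: deriveM; apply: diff_derivable; [exact: (sA 1%N).1|exact: (sB 1%N).1].
have sev th v : smooth W th -> smooth N (fun t => ev th t v).
  by move=> sth k; exact: Ck_sub NW (Ck_ev v oW (sth k)).
have sD (f : 'rV[R]_2 -> R) v : smooth N f -> smooth N ('D_v f) by move=> sf k; exact: (sf k.+1).2.
(* Cramer's rule for [df0 = g th0]: the quotient of [df0 /\ th1] by [th0 /\ th1]. *)
pose g t := ('D_d0 f0 t * ev th1 t d1 - 'D_d1 f0 t * ev th1 t d0) / Om t.
have gE t : N t -> forall v, 'D_v f0 t = g t * ev th0 t v /\ 'D_v f1 t = g t * ev th1 t v.
  move=> Nt v; have O := wedge_frame_neq0 (NW t Nt).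
  rewrite !(Dlin _ t v)// (evlin th0 t v) (evlin th1 t v).
  (* For a form [th], the vector [w (ev th t d1) (ev th t d0)] lies in its kernel; testing the
     hypotheses on it yields the vanishing of the exterior products [K0], [K1], [K2]. *)
  pose w (a b : R) : 'rV[R]_2 := a *: d0 - b *: d1.
  have wE a b : w a b 0 0 = a /\ w a b 0 1 = - b.
    by rewrite !mxE/= !mulr1 !mulr0 subr0 sub0r.
  have K0 : ev th0 t d1 * 'D_d0 f0 t - ev th0 t d0 * 'D_d1 f0 t = 0.
    have [w0 w1] := wE (ev th0 t d1) (ev th0 t d0).
    have := (H0 t (w (ev th0 t d1) (ev th0 t d0)) Nt).1.
    by rewrite evlin Dlin// w0 w1 !mulNr; apply; ring.
  have K1 : ev th1 t d1 * 'D_d0 f1 t - ev th1 t d0 * 'D_d1 f1 t = 0.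
    have [w0 w1] := wE (ev th1 t d1) (ev th1 t d0).
    have := H1 t (w (ev th1 t d1) (ev th1 t d0)) Nt.
    by rewrite evlin Dlin// w0 w1 !mulNr; apply; ring.
  have K2 : (ev th0 t d1 + ev th1 t d1) * ('D_d0 f0 t + 'D_d0 f1 t) -
            (ev th0 t d0 + ev th1 t d0) * ('D_d1 f0 t + 'D_d1 f1 t) = 0.
    pose A := ev th0 t d1 + ev th1 t d1; pose B := ev th0 t d0 + ev th1 t d0.
    have [w0 w1] := wE A B; have := H2 t (w A B) Nt.
    rewrite (evlin th0) (evlin th1) (Dlin f0)// (Dlin f1)// w0 w1 => K.
    by apply: etrans _ (K _); rewrite /A /B; ring.
  rewrite /g; move: O K0 K1 K2; rewrite /Om.
  move: (ev th0 t d0) (ev th0 t d1) (ev th1 t d0) (ev th1 t d1).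
  move: ('D_d0 f0 t) ('D_d1 f0 t) ('D_d0 f1 t) ('D_d1 f1 t).
  move=> p0 p1 q0 q1 x0 x1 y0 y1 O K0 K1 K2.
  have G (a b c : R) : c * (x0 * y1 - x1 * y0) = a * b -> c = a / (x0 * y1 - x1 * y0) * b.
    by move=> E; apply: (mulIf O); rewrite E mulrAC divfK// .
  have K3 : p0 * y1 - p1 * y0 = x0 * q1 - x1 * q0.
    have -> : p0 * y1 - p1 * y0 = x0 * q1 - x1 * q0 +
      ((x1 + y1) * (p0 + q0) - (x0 + y0) * (p1 + q1)
       - (x1 * p0 - x0 * p1) - (y1 * q0 - y0 * q1)) by ring.
    by rewrite K0 K1 K2 !subr0 addr0.
  split; apply: G; last rewrite K3; move: (v 0 0) (v 0 1) => v0 v1.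
    have -> : (v0 * p0 + v1 * p1) * (x0 * y1 - x1 * y0) =
      (p0 * y1 - p1 * y0) * (v0 * x0 + v1 * x1)
      - (v0 * y0 + v1 * y1) * (x1 * p0 - x0 * p1) by ring.
    by rewrite K0 mulr0 subr0.
  have -> : (v0 * q0 + v1 * q1) * (x0 * y1 - x1 * y0) =
    (x0 * q1 - x1 * q0) * (v0 * y0 + v1 * y1)
    + (v0 * x0 + v1 * x1) * (y1 * q0 - y0 * q1) by ring.
  by rewrite K1 mulr0 addr0.
have sg : smooth N g.
  move=> k; apply: CkM => //.
    apply: CkD => //; last apply: CkN => //; apply: CkM => //;
    first [exact: sD|exact: sev].
  apply: CkV => // [t Nt|]; first exact/wedge_frame_neq0/NW.
  apply: CkD => //; last apply: CkN => //; apply: CkM => //; exact: sev.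
(* From [d(g th) = 0] and [d th = th /\ ga], the form [dg - g ga] has zero exterior product with
   both [th0] and [th1], hence it vanishes. *)
have kap t v : N t -> 'D_v g t = g t * ev ga t v.
  move=> Nt; have Wt := NW t Nt; have O := wedge_frame_neq0 Wt.
  pose ka v := 'D_v g t - g t * ev ga t v.
  have kaE th f u w : smooth W th -> smooth N f ->
      (forall s v w, W s -> ext_d th s v w = wedge1 th ga s v w) ->
      (forall s v, N s -> 'D_v f s = g s * ev th s v) ->
      ka u * ev th t w = ka w * ev th t u.
    move=> sth sf dth fE; have := swap f t u w sf Nt.
    rewrite (Dmul _ g _ t u sg (sev th w sth) Nt (fun s Ns => fE s w Ns)).
    rewrite (Dmul _ g _ t w sg (sev th u sth) Nt (fun s Ns => fE s u Ns)).
    have := dth t u w Wt; rewrite /ext_d /wedge1 /ka.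
    move: ('D_u (fun s => ev th s w) t) ('D_w (fun s => ev th s u) t) => A B.
    move: ('D_u g t) ('D_w g t) (ev th t u) (ev th t w) (ev ga t u) (ev ga t w) (g t).
    move=> gu gw tu tw cu cw gt dE E; apply/eqP; rewrite -subr_eq0; apply/eqP.
    have -> : (gu - gt * cu) * tw - (gw - gt * cw) * tu =
      (gt * A + tw * gu - (gt * B + tu * gw)) - gt * (A - B - (tu * cw - tw * cu))
      by ring.
    by rewrite E dE !subrr mulr0 subr0.
  have [k0 k1] : ka d0 = 0 /\ ka d1 = 0.
    apply: (plane_proportional O).
      by apply: kaE sth0 sf0 dth0 _ => s v' Ns; exact: (gE s Ns v').1.
    by apply: kaE sth1 sf1 dth1 _ => s v' Ns; exact: (gE s Ns v').2.
  have : ka v = 0.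
    rewrite /ka (Dlin g t v)// (evlin ga t v); move: k0 k1; rewrite /ka.
    move=> k0 k1.
    have -> : 'D_d0 g t = g t * ev ga t d0 by apply/eqP; rewrite -subr_eq0 k0.
    have -> : 'D_d1 g t = g t * ev ga t d1 by apply/eqP; rewrite -subr_eq0 k1.
    ring.
  by move/eqP; rewrite subr_eq0 => /eqP.
(* Where [g] vanishes [df0] is zero, and the equivalence of kernels then makes [th0] zero as well.
   With [g] nonzero, [dg = g ga] and [d(dg) = 0] give [g d ga = 0], since [dg /\ ga = 0]. *)
move=> t v w Nt; have g0 : g t != 0.
  apply/eqP => g0; have := wedge_frame_neq0 (NW t Nt); rewrite /Om.
  have z v' : ev th0 t v' = 0 by apply/(H0 t v' Nt).2; rewrite (gE t Nt v').1 g0 mul0r.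
  by rewrite !z !mul0r subrr eqxx.
apply: (mulfI g0); rewrite mulr0 /ext_d.
have := swap g t v w sg Nt.
rewrite (Dmul _ g _ t v sg (sev ga w sga) Nt (fun s Ns => kap s w Ns)).
rewrite (Dmul _ g _ t w sg (sev ga v sga) Nt (fun s Ns => kap s v Ns)).
rewrite !kap//; set A := 'D_v _ t; set B := 'D_w _ t => E.
rewrite mulrBr; apply/eqP; rewrite subr_eq0; apply/eqP.
by apply: (addIr (ev ga t w * (g t * ev ga t v))); rewrite E; congr (_ + _); ring.
Qed.

Variable F : 'I_3 -> vdistribution R 2.
Hypothesis F0 : forall s, W s -> F 0 s = [set v | ev th0 s v = 0].
Hypothesis F1 : forall s, W s -> F 1 s = [set v | ev th1 s v = 0].
Hypothesis F2 : forall s, W s -> F ord_max s = [set v | ev th0 s v + ev th1 s v = 0].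

Lemma hexagonal_closed : hexagonal W F ->
  forall s v w, W s -> ext_d ga s v w = 0.
Proof.
move=> hex s v w Ws.
have [N [N' [phi [e [Ns NW [oN oN' _ sphi _] efree FE]]]]] := hex s Ws.
have ecr u u' : u != u' -> cross (e u) (e u') != 0.
  by move=> /efree; rewrite row_free_cross.
pose e0 := e 0; pose e1 := e 1; pose e2 := e ord_max.
have c01 : cross e0 e1 != 0 by exact: ecr.
have c10 : cross e1 e0 != 0 by exact: ecr.
have c21 : cross e2 e1 != 0 by exact: ecr.
have c20 : cross e2 e0 != 0 by exact: ecr.
have c02 : cross e0 e2 != 0 by exact: ecr.
(* [cross . (e u)] annihilates the direction [e u]; the coefficients [cross e2 e1] and
   [cross e0 e2] make the sum of the first two functions a multiple of the third. *)
pose f (k : R) (u : 'rV[R]_2) t := k * cross (phi t) u.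
have sphiE i : smooth N (fun t => phi t 0 i).
  by move=> k; exact: ((Ck_mxP _ _ oN).1 (sphi k)).
have sf k u : smooth N (f k u).
  move=> m; apply: CkM => //; first exact: Ck_cst.
  apply: CkD => //; last apply: CkN => //; apply: CkM => //;
  first [exact: Ck_cst|exact: sphiE].
have dphi t : N t -> differentiable phi t by exact: (sphi 1%N).1.
have Df k u t x : N t -> 'D_x (f k u) t = k * cross ('d phi t x) u.
  move=> Nt; have d i : is_derive t x (fun t => phi t 0 i) ('d phi t x 0 i).
    apply: DeriveDef; first exact/diff_derivable/differentiable_entry/dphi.
    by rewrite derive_entry ?deriveE//; exact: dphi.
  have [_ E] := is_deriveZ k (is_deriveB (is_deriveZ (u 0 1) (d 0))
    (is_deriveZ (u 0 0) (d 1))).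
  rewrite (_ : f k u = k \*: (u 0 1 \*: (fun t => phi t 0 0) -
    u 0 0 \*: (fun t => phi t 0 1))).
    by apply: etrans E _; rewrite /cross ![_ 0 _ * u 0 _]mulrC.
  by apply/funext => z; rewrite /f /cross ![phi z 0 _ * _]mulrC.
have NWt t (Nt : N t) := NW t Nt.
apply: (@closed_of_exact_annihilators N (f (cross e2 e1) e0) (f (cross e0 e2) e1)) => //.
- move=> t x Nt; rewrite Df//.
  have : F 0 t x <-> ('d phi t x <= e 0)%MS by rewrite FE.
  rewrite F0//=; last exact: NWt.
  move=> ->; rewrite (submx_cross _ c01).
  split=> [->|/eqP]; first by rewrite mulr0.
  by rewrite mulf_eq0 (negPf c21) => /eqP.
- move=> t x Nt; rewrite Df//.
  have : F 1 t x <-> ('d phi t x <= e 1)%MS by rewrite FE.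
  rewrite F1//=; last exact: NWt.
  by move=> ->; rewrite (submx_cross _ c10) => ->; rewrite mulr0.
- move=> t x Nt; rewrite !Df//.
  have : F ord_max t x <-> ('d phi t x <= e ord_max)%MS by rewrite FE.
  rewrite F2//=; last exact: NWt.
  move=> ->; rewrite (submx_cross _ c20) => E.
  have -> : cross e2 e1 * cross ('d phi t x) e0 + cross e0 e2 * cross ('d phi t x) e1
    = cross e0 e1 * cross ('d phi t x) e2 by rewrite /cross; ring.
  by rewrite E mulr0.
Qed.

Lemma closed_hexagonal :
  (forall s v w, W s -> ext_d ga s v w = 0) -> hexagonal W F.
Proof.
move=> cl s Ws.
have [N [h [oN Ns NW hga]]] := poincare oW Ws (sga 2%N) cl.
have sh : smooth N h.
  by apply: (smooth_primitive oN _ hga) => k; exact: Ck_sub NW (sga k).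
pose E t := expR (h t).
have sE : smooth N E by move=> k; exact: Ck_expR.
have DE t v : N t -> 'D_v E t = E t * ev ga t v.
  move=> Nt; have [dh Dh] := hga t Nt.
  have dexp : differentiable (@expR R) (h t) by exact/derivable1_diffP/derivable_expR.
  apply: etrans (derive_comp v dh dexp) _.
  rewrite Dh deriveE// -[X in 'd _ _ X]mulr1 linearZ/= -deriveE//.
  by have [_ ->] := is_derive_expR (h t); rewrite mulrC.
have primitive th : smooth W th ->
    (forall s v w, W s -> ext_d th s v w = wedge1 th ga s v w) ->
    exists N0 f, [/\ open N0, N0 s, N0 `<=` N, smooth N0 f &
      forall t v, N0 t -> 'D_v f t = E t * ev th t v].
  move=> sth dth; pose th' : one_form R 2 := fun t => E t *: th t.
  have ev' t v : ev th' t v = E t * ev th t v.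
    by rewrite /ev /th' -scalemxAr mxE.
  have sth' : smooth N th'.
    move=> k; apply/(Ck_mxP _ _ oN) => i j.
    apply: (eq_Ck oN _ (CkM oN (sE k) ((Ck_mxP _ _ oN).1 (Ck_sub NW (sth k)) i j))).
    by move=> t _; rewrite mxE.
  (* The term [dE /\ th = E ga /\ th] cancels [E d th = E th /\ ga]. *)
  have cl' t v w : N t -> ext_d th' t v w = 0.
    move=> Nt; have Wt := NW t Nt.
    have D u u' : 'D_u (fun y => ev th' y u') t =
        E t * 'D_u (fun y => ev th y u') t + ev th t u' * 'D_u E t.
      rewrite (_ : (fun y => ev th' y u') = E * (fun y => ev th y u')).
        apply: deriveM; apply: diff_derivable; first exact: (sE 1%N).1.
        exact: (Ck_ev u' oW (sth 1%N)).1.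
      by apply/funext => y; exact: ev'.
    have := dth t v w Wt; rewrite /ext_d /wedge1 !D !DE// => dE.
    set A := 'D_v _ t in dE *; set B := 'D_w _ t in dE *.
    have -> : A = B + (ev th t v * ev ga t w - ev th t w * ev ga t v).
      by rewrite -dE addrC subrK.
    ring.
  have [N0 [f [oN0 N0s N0N fth]]] := poincare oN Ns (sth' 2%N) cl'.
  exists N0, f; split => //.
    by apply: (smooth_primitive oN0 _ fth) => k; exact: Ck_sub N0N (sth' k).
  by move=> t v /fth[_ ->].
have [N0 [f0 [oN0 N0s N0N sf0 Df0]]] := primitive th0 sth0 dth0.
have [N1 [f1 [oN1 N1s N1N sf1 Df1]]] := primitive th1 sth1 dth1.
pose M := N0 `&` N1; have oM : open M by exact: openI.
have Ms : M s by [].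
have MW : M `<=` W by move=> t [/N0N/NW].
have O := wedge_frame_neq0 Ws; have Es : E s != 0 by rewrite gt_eqF// expR_gt0.
(* [u0], [u1] form the basis dual to [E th0], [E th1] at [s], which makes the differential of [phi]
   at [s] the identity, as [inverse_function] requires. *)
pose c := (E s * Om s)^-1; have c0 : c != 0 by rewrite invr_neq0// mulf_neq0.
pose u0 : 'rV[R]_2 := c *: (ev th1 s d1 *: d0 - ev th1 s d0 *: d1).
pose u1 : 'rV[R]_2 := c *: (ev th0 s d0 *: d1 - ev th0 s d1 *: d0).
have u01 : cross u0 u1 = c * c * Om s.
  by rewrite /cross !mxE/= /Om; ring.
pose phi t := f0 t *: u0 + f1 t *: u1.
have Dphi t v : M t -> 'D_v phi t = (E t * ev th0 t v) *: u0 + (E t * ev th1 t v) *: u1.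
  move=> [N0t N1t].
  have df0 : differentiable f0 t by exact: (sf0 1%N).1.
  have df1 : differentiable f1 t by exact: (sf1 1%N).1.
  have Z (f : 'rV[R]_2 -> R) (u : 'rV[R]_2) : differentiable f t ->
      'D_v (fun t => f t *: u) t = 'D_v f t *: u.
    move=> df; rewrite (deriveE v (differentiableZl u df)) (deriveE v df).
    by rewrite (diffZl u df).
  have D0 := diff_derivable (v := v) (differentiableZl u0 df0).
  have D1 := diff_derivable (v := v) (differentiableZl u1 df1).
  by apply: etrans (deriveD D0 D1) _; rewrite (Z _ _ df0) (Z _ _ df1) Df0 ?Df1.
have sphi : smooth M phi.
  move=> k; apply: CkD => //; apply: CkZl => //.
    by apply: Ck_sub (sf0 k) => t [].
  by apply: Ck_sub (sf1 k) => t [].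
have Dphis v : 'D_v phi s = v.
  have vE : v = v 0 0 *: d0 + v 0 1 *: d1 by rewrite [LHS]row_sum_delta sum2.
  have evs th : ev th s v = v 0 0 * ev th s d0 + v 0 1 * ev th s d1.
    by rewrite {1}vE linearD !linearZ.
  rewrite Dphi// (evs th0) (evs th1).
  move: O Es; rewrite /u0 /u1 /c /Om => O Es.
  by apply: row2P; rewrite !mxE/=; field; rewrite Es O.
have [K [K' [Ks KM dK]]] := inverse_function oM Ms sphi Dphis.
(* Along a leaf of [th0 = 0] the [u0]-coordinate [f0] is constant, so the direction is [u1];
   likewise [u0] for [th1 = 0], and [u0 - u1] where [f0 + f1] is constant. *)
pose e (u : 'I_3) := if u == 0 then u1 else if u == 1 then u0 else u0 - u1.
have c01 : cross u0 u1 != 0.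
  by rewrite u01 !mulf_neq0.
have c10 : cross u1 u0 != 0.
  by rewrite (_ : cross u1 u0 = - cross u0 u1) ?oppr_eq0// /cross; ring.
have I3 (P : 'I_3 -> Prop) : P 0 -> P 1 -> P ord_max -> forall u, P u.
  move=> P0 P1 P2 [[|[|[|u]]] Hu] //.
  - by rewrite (_ : Ordinal Hu = 0)//; apply: val_inj.
  - by rewrite (_ : Ordinal Hu = 1)//; apply: val_inj.
  - by rewrite (_ : Ordinal Hu = ord_max)//; apply: val_inj.
have x0 : cross u0 (u0 - u1) = cross u1 u0 by rewrite /cross !mxE; ring.
have x1 : cross u1 (u0 - u1) = cross u1 u0 by rewrite /cross !mxE; ring.
have x2 : cross (u0 - u1) u0 = cross u0 u1 by rewrite /cross !mxE; ring.
have x3 : cross (u0 - u1) u1 = cross u0 u1 by rewrite /cross !mxE; ring.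
exists K, K', phi, e; split => //; first exact: subset_trans KM MW.
  by move=> u u'; rewrite row_free_cross /e; elim/I3: u; elim/I3: u' => //= _;
    rewrite ?x0 ?x1 ?x2 ?x3.
move=> u t Kt; have Mt := KM t Kt; have Wt := MW t Mt.
have dphi v : 'd phi t v = (E t * ev th0 t v) *: u0 + (E t * ev th1 t v) *: u1.
  by rewrite -(Dphi t v Mt) (deriveE v ((sphi 1%N).1 t Mt)).
have Et : E t != 0 by rewrite gt_eqF// expR_gt0.
have c21 : cross (u0 - u1) u0 != 0 by rewrite x2.
elim/I3: u; rewrite /e/= ?F0 ?F1 ?F2//; apply/funext => v; apply/propext;
  rewrite /= dphi.
- rewrite (submx_cross _ c10) crossD.
  rewrite (_ : cross u1 u1 = 0) ?mulr0 ?addr0; last by rewrite /cross; ring.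
  split=> [->|/eqP]; first by rewrite mulr0 mul0r.
  by rewrite !mulf_eq0 (negPf c01) (negPf Et) orbF => /eqP.
- rewrite (submx_cross _ c01) crossD.
  rewrite (_ : cross u0 u0 = 0) ?mulr0 ?add0r; last by rewrite /cross; ring.
  split=> [->|/eqP]; first by rewrite mulr0 mul0r.
  by rewrite !mulf_eq0 (negPf c10) (negPf Et) orbF => /eqP.
- rewrite (submx_cross _ c21) crossD.
  have -> : E t * ev th0 t v * cross u0 (u0 - u1) + E t * ev th1 t v * cross u1 (u0 - u1)
     = - (E t * cross u0 u1) * (ev th0 t v + ev th1 t v) by rewrite /cross !mxE; ring.
  split=> [->|/eqP]; first by rewrite mulr0.
  by rewrite mulf_eq0 oppr_eq0 mulf_eq0 (negPf c01) (negPf Et) => /eqP.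
Qed.

End Coframe.

End PlaneWebs.

(** * Pullback to a surface *)

Section Pullback.
Context {R : realType} {m n : nat}.
Variables (W : set 'rV[R]_m) (U : set 'rV[R]_n) (f : 'rV[R]_m -> 'rV[R]_n).
Hypotheses (oW : open W) (oU : open U) (sf : smooth W f)
  (fU : forall s, W s -> U (f s)).

Definition pullback (th : one_form R n) : one_form R m :=
  fun s => jacobian f s *m th (f s).

Definition dform (g : 'rV[R]_m -> R) : one_form R m :=
  fun s => \col_i 'D_(delta_mx 0 i) g s.

Let df s : W s -> differentiable f s. Proof. exact: (sf 1%N).1. Qed.

Lemma ev_pullback th s v : W s -> ev (pullback th) s v = ev th (f s) ('D_v f s).
Proof. by move=> Ws; rewrite /ev /pullback mulmxA -deriveEjacobian//; exact: df. Qed.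

Lemma smooth_comp (g : 'rV[R]_n -> R) : smooth U g -> smooth W (fun s => g (f s)).
Proof. by move=> sg k; exact: (Ck_comp oW fU (sf k) (sg k)). Qed.

Lemma smooth_pullback th : smooth U th -> smooth W (pullback th).
Proof.
move=> sth k; apply/(Ck_mxP _ _ oW) => i j.
apply: (@eq_Ck _ _ _ k W
    (fun s => \sum_l 'D_(delta_mx 0 i) f s 0 l * th (f s) l j)) => //.
  move=> s Ws; rewrite mxE; apply: eq_bigr => l _; congr (_ * _).
  by rewrite deriveEjacobian -?rowE ?mxE//; exact: df.
apply: Ck_sum => // l _; apply: CkM => //.
  exact: ((Ck_mxP _ _ oW).1 ((sf k.+1).2 _)).
by apply: (@smooth_comp (fun z => th z l j)) => k'; exact: ((Ck_mxP _ _ oU).1 (sth k')).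
Qed.

Lemma ev_dform g s v : differentiable g s -> ev (dform g) s v = 'D_v g s.
Proof.
move=> dg; rewrite derive_delta// evE; apply: eq_bigr => i _.
by rewrite mxE.
Qed.

Lemma smooth_dform g : smooth W g -> smooth W (dform g).
Proof.
move=> sg k; apply/(Ck_mxP _ _ oW) => i j.
by apply: (eq_Ck oW _ ((sg k.+1).2 (delta_mx 0 i))) => s Ws; rewrite mxE.
Qed.

Lemma derive_ev_pullback th s v w : smooth U th -> W s ->
  'D_v (fun y => ev (pullback th) y w) s =
  ev th (f s) ('D_v ('D_w f) s) +
  'D_('D_v f s) (fun z => ev th z ('D_w f s)) (f s).
Proof.
move=> sth Ws; have dfs := df Ws.
have dth : differentiable th (f s) by exact/(sth 1%N).1/fU.
have [_ ->] := is_derive_ev ('D_v f s) ('D_w f s) dth.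
have dDf : differentiable ('D_w f) s by exact: ((sf 2%N).2 w).1.
have -> : 'D_v (fun y => ev (pullback th) y w) s =
    'D_v (\sum_l (fun y => 'D_w f y 0 l * th (f y) l 0)) s.
  apply: near_eq_derive; have := near_open oW Ws; apply: filterS => y Wy.
  by rewrite ev_pullback// evE fct_sumE.
have D : is_derive s v (\sum_l (fun y => 'D_w f y 0 l * th (f y) l 0))
   (\sum_l ('D_w f s 0 l * 'D_('D_v f s) th (f s) l 0 +
            th (f s) l 0 * 'D_v ('D_w f) s 0 l)).
  apply: is_derive_sum => l.
  have h1 : is_derive s v (fun y => 'D_w f y 0 l) ('D_v ('D_w f) s 0 l).
    apply: DeriveDef; last exact: derive_entry.
    exact/diff_derivable/differentiable_entry.
  have h2 : is_derive s v (fun y => th (f y) l 0) ('D_('D_v f s) th (f s) l 0).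
    have dc : differentiable (th \o f) s by exact: differentiable_comp.
    apply: DeriveDef; first exact/diff_derivable/(differentiable_entry l 0 dc).
    by rewrite (derive_entry v l 0 dc) (derive_comp v dfs dth).
  exact: (is_deriveM h1 h2).
have [_ ->] := D; rewrite big_split/= addrC; congr (_ + _).
  by rewrite evE; apply: eq_bigr => l _; rewrite mulrC.
by rewrite mxE.
Qed.

(** Besides the pulled-back derivative of [th], [derive_ev_pullback] contains [th] applied to a
    second derivative of [f]; that term is symmetric in [v] and [w] and cancels on alternation. *)
Lemma ext_d_pullback th s v w : smooth U th -> W s ->
  ext_d (pullback th) s v w = ext_d th (f s) ('D_v f s) ('D_w f s).
Proof.
move=> sth Ws; rewrite /ext_d !derive_ev_pullback//.
have -> : 'D_v ('D_w f) s = 'D_w ('D_v f) s.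
  apply/rowP => l; have dDf u : differentiable ('D_u f) s by exact: ((sf 2%N).2 u).1.
  have E u u' : 'D_u ('D_u' f) s 0 l = 'D_u ('D_u' (fun y => f y 0 l)) s.
    rewrite -(derive_entry u 0 l (dDf u')); apply: near_eq_derive.
    have := near_open oW Ws; apply: filterS => y Wy.
    by rewrite derive_entry//; exact: df.
  apply: etrans (E v w) _; apply: etrans _ (esym (E w v)).
  exact: (derive_swap v w oW ((Ck_mxP 2 f oW).1 (sf 2%N) 0 l) Ws).
by rewrite opprD addrACA subrr add0r.
Qed.

Lemma wedge1_pullback al be s v w : W s ->
  wedge1 (pullback al) (pullback be) s v w = wedge1 al be (f s) ('D_v f s) ('D_w f s).
Proof. by move=> Ws; rewrite /wedge1 !ev_pullback. Qed.

End Pullback.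

(** * Webs on the integral surfaces *)

Section Reduction.
Context {R : realType}.
Variables (U : set 'rV[R]_4) (W : set 'rV[R]_2) (f : 'rV[R]_2 -> 'rV[R]_4).
Variables (conn : 'I_2 -> 'I_2 -> one_form R 4) (a c : 'I_2 -> 'rV[R]_4 -> R).
Hypotheses (oU : open U) (oW : open W) (sf : smooth W f)
  (fU : forall s, W s -> U (f s)).
Hypotheses (sconn : forall i j, smooth U (conn j i)).
Hypotheses (sa : forall i, smooth U (a i)) (sc : forall i, smooth U (c i)).
Hypothesis hD : forall x, U x -> coframe_det a c x != 0.
Implicit Types (s v w : 'rV[R]_2).

(* The vector [v] of the proof idea, along the surface. *)
Definition direction (i : 'I_2) s : R :=
  (if i == 0 then - a 1 (f s) else a 0 (f s)) / coframe_det a c (f s).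

Let V := direction.

Lemma direction_a s : a 0 (f s) * V 0 s + a 1 (f s) * V 1 s = 0.
Proof. by rewrite /V /direction/=; ring. Qed.

Lemma direction_c s : W s -> c 0 (f s) * V 0 s + c 1 (f s) * V 1 s = 1.
Proof.
by move=> Ws; have := hD (fU Ws); rewrite /V /direction/= /coframe_det => D; field.
Qed.

(** [V] belongs to the frame dual to the pair of covectors [(a, c)]: it is killed by [a] and has
    value 1 on [c]. On the kernel of [a] the value of [c] is therefore the coordinate along [V]. *)
Lemma direction_spans s (x : 'I_2 -> R) : W s ->
  a 0 (f s) * x 0 + a 1 (f s) * x 1 = 0 ->
  forall i, x i = V i s * (c 0 (f s) * x 0 + c 1 (f s) * x 1).
Proof.
move=> Ws ax i; have D := hD (fU Ws); apply: (mulfI D).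
rewrite /V /direction mulrA [coframe_det _ _ _ * (_ / _)]mulrC divfK//.
rewrite /coframe_det; have [->|->] : i = 0 \/ i = 1.
- by case: i => [[|[|]]] // ?; [left|right]; apply: val_inj.
- rewrite /=; have -> : (a 0 (f s) * c 1 (f s) - a 1 (f s) * c 0 (f s)) * x 0 =
    - a 1 (f s) * (c 0 (f s) * x 0 + c 1 (f s) * x 1) +
    c 1 (f s) * (a 0 (f s) * x 0 + a 1 (f s) * x 1) by ring.
  by rewrite ax mulr0 addr0.
- rewrite /=; have -> : (a 0 (f s) * c 1 (f s) - a 1 (f s) * c 0 (f s)) * x 1 =
    a 0 (f s) * (c 0 (f s) * x 0 + c 1 (f s) * x 1) -
    c 0 (f s) * (a 0 (f s) * x 0 + a 1 (f s) * x 1) by ring.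
  by rewrite ax mulr0 subr0.
Qed.

Lemma smooth_direction i : smooth W (V i).
Proof.
have sW (g : 'rV[R]_4 -> R) : smooth U g -> smooth W (fun s => g (f s)).
  exact: smooth_comp.
move=> k; apply: CkM => //.
  by case: (i == 0); [apply: CkN => //|]; exact: sW.
apply: CkV => // [s /fU/hD//|]; apply: (@sW (coframe_det a c)) => k'.
by apply: CkD => //; last apply: CkN => //; apply: CkM => //; [exact: sa|exact: sc|exact: sa|exact: sc].
Qed.

Definition conn_on (j i : 'I_2) : one_form R 2 := pullback f (conn j i).

Let C := conn_on.

(* [dv^i + v^j omega_j^i] on the surface. *)
Definition cov (i : 'I_2) s v : R := 'D_v (V i) s + \sum_j V j s * ev (C j i) s v.

Let N := cov.

(** The form [gamma]. [cov] is only a function of a point and a vector, so its contraction with [c]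
    is written out as a field of columns, to which [ext_d] and [smooth] apply. *)
Definition web_conn : one_form R 2 := fun s =>
  \sum_i c i (f s) *: (dform (V i) s + \sum_j V j s *: C j i s).

Let ga := web_conn.

Definition contracted_form (om : 'I_2 -> one_form R 4) : one_form R 2 := fun s =>
  \sum_i c i (f s) *: pullback f (om i) s.

Lemma ev_sum2 (k : 'I_2 -> R) (F : 'I_2 -> 'cV[R]_2) v :
  (v *m (\sum_i k i *: F i)) 0 0 = \sum_i k i * (v *m F i) 0 0.
Proof.
by rewrite mulmx_sumr summxE; apply: eq_bigr => i _; rewrite -scalemxAr mxE.
Qed.

Lemma ev_contracted_form om s v : ev (contracted_form om) s v =
  c 0 (f s) * ev (pullback f (om 0)) s v + c 1 (f s) * ev (pullback f (om 1)) s v.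
Proof. by rewrite /ev /contracted_form ev_sum2 sum2. Qed.

Lemma ev_web_conn s v : W s ->
  ev ga s v = c 0 (f s) * N 0 s v + c 1 (f s) * N 1 s v.
Proof.
move=> Ws; rewrite /ev /ga /web_conn ev_sum2 sum2.
suff E i : (v *m (dform (V i) s + \sum_j V j s *: C j i s)) 0 0 = N i s v by rewrite !E.
rewrite mulmxDr mxE -[X in X + _]/(ev (dform (V i)) s v) ev_dform; last first.
  exact: (smooth_direction i 1%N).1.
by rewrite ev_sum2.
Qed.

Lemma smooth_scale (g : 'rV[R]_2 -> R) (th : one_form R 2) :
  smooth W g -> smooth W th -> smooth W (fun s => g s *: th s).
Proof.
move=> sg sth k; apply/(Ck_mxP _ _ oW) => i j.
apply: (eq_Ck oW _ (CkM oW (sg k) ((Ck_mxP _ _ oW).1 (sth k) i j))) => s _.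
by rewrite mxE.
Qed.

Let smooth_cf i : smooth W (fun s => c i (f s)).
Proof. exact: smooth_comp (sc i). Qed.

Lemma smooth_contracted_form om : (forall i, smooth U (om i)) -> smooth W (contracted_form om).
Proof.
move=> som k; apply: Ck_sum => // i _; apply: smooth_scale => //.
exact: smooth_pullback (som i).
Qed.

Let smooth_C j i : smooth W (C j i).
Proof. exact: smooth_pullback (sconn i j). Qed.

Lemma smooth_web_conn : smooth W ga.
Proof.
move=> k; apply: Ck_sum => // i _; apply: smooth_scale => // k'.
apply: CkD => //; first exact: smooth_dform (smooth_direction i) k'.
by apply: Ck_sum => // j _; apply: smooth_scale => //; exact: smooth_direction.
Qed.

Lemma derive_prod (F A B : 'rV[R]_2 -> R) s v :
  smooth W A -> smooth W B -> W s -> (forall s, W s -> F s = A s * B s) ->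
  'D_v F s = A s * 'D_v B s + B s * 'D_v A s.
Proof.
move=> sA sB Ws FE; have -> : 'D_v F s = 'D_v (fun s => A s * B s) s.
  by apply: near_eq_derive; have := near_open oW Ws; apply: filterS => t /FE.
by apply: deriveM; apply: diff_derivable; [exact: (sA 1%N).1|exact: (sB 1%N).1].
Qed.

Let sev th v : smooth W th -> smooth W (fun s => ev th s v).
Proof. by move=> sth k; exact: Ck_ev. Qed.

(** * The equations of a single family, whose torsion term carries the coefficient [e] *)

Section OneFamily.
Variables (om : 'I_2 -> one_form R 4) (e : R).
Hypothesis som : forall i, smooth U (om i).
Hypothesis tangent : forall s v, W s ->
  a 0 (f s) * ev (om 0) (f s) ('D_v f s) + a 1 (f s) * ev (om 1) (f s) ('D_v f s) = 0.
Hypothesis dom : forall i x (v w : 'rV[R]_4), U x -> ext_d (om i) x v w =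
  \sum_j wedge1 (om j) (conn j i) x v w
  + e * \sum_j a j x * wedge1 (om j) (om i) x v w.
Let th := contracted_form om.

Lemma ev_family i s v : W s -> ev (pullback f (om i)) s v = V i s * ev th s v.
Proof.
move=> Ws; rewrite /th ev_contracted_form.
apply: (@direction_spans s (fun i => ev (pullback f (om i)) s v)) => //.
by rewrite !(ev_pullback sf)//; exact: tangent.
Qed.

(** Exterior derivative of [omega^i = V^i theta]: the structure equation gives [dV^i /\ theta + V^i
    d theta = V^j theta /\ omega_j^i]. The torsion term has disappeared because all [omega^i] are
    multiples of the same [theta]. *)
Lemma family_cov i s v w : W s ->
  V i s * ext_d th s v w = ev th s v * N i s w - ev th s w * N i s v.
Proof.
move=> Ws.
have sth : smooth W th by exact: smooth_contracted_form.
have E : ext_d (pullback f (om i)) s v w =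
    ev th s v * (\sum_j V j s * ev (C j i) s w)
    - ev th s w * (\sum_j V j s * ev (C j i) s v).
  rewrite (ext_d_pullback oW sf fU v w (som i) Ws) dom; last exact: fU.
  rewrite !sum2 -!(wedge1_pullback sf _ _ _ _ Ws) /wedge1 !ev_family//.
  by rewrite /C /conn_on; ring.
have D u u' : 'D_u (fun y => ev (pullback f (om i)) y u') s =
    V i s * 'D_u (fun y => ev th y u') s + ev th s u' * 'D_u (V i) s.
  apply: (derive_prod u (smooth_direction i) (sev u' sth) Ws) => y Wy.
  exact: ev_family.
move: E; rewrite /ext_d !D /N /cov => E.
have alg (x A B tv tw gv gw Sv Sw : R) :
    x * A + tw * gv - (x * B + tv * gw) = tv * Sw - tw * Sv ->
    x * (A - B) = tv * (gw + Sw) - tw * (gv + Sv).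
  move=> H; have -> : tv * (gw + Sw) - tw * (gv + Sv) =
    tv * Sw - tw * Sv + tv * gw - tw * gv by ring.
  by rewrite -H; ring.
exact: alg E.
Qed.

Lemma contracted_form_structure s v w : W s -> ext_d th s v w = wedge1 th ga s v w.
Proof.
move=> Ws; have E0 := family_cov 0 v w Ws; have E1 := family_cov 1 v w Ws.
rewrite /wedge1 !ev_web_conn// -[LHS]mul1r -(direction_c Ws).
rewrite mulrDl -(mulrA (c 0 (f s))) -(mulrA (c 1 (f s))) E0 E1; ring.
Qed.

Lemma family_annihilated s v w : W s ->
  ev th s v * (a 0 (f s) * N 0 s w + a 1 (f s) * N 1 s w) =
  ev th s w * (a 0 (f s) * N 0 s v + a 1 (f s) * N 1 s v).
Proof.
move=> Ws; have E0 := family_cov 0 v w Ws; have E1 := family_cov 1 v w Ws.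
apply/eqP; rewrite -subr_eq0; apply/eqP.
have -> : ev th s v * (a 0 (f s) * N 0 s w + a 1 (f s) * N 1 s w) -
  ev th s w * (a 0 (f s) * N 0 s v + a 1 (f s) * N 1 s v) =
  a 0 (f s) * (ev th s v * N 0 s w - ev th s w * N 0 s v) +
  a 1 (f s) * (ev th s v * N 1 s w - ev th s w * N 1 s v) by ring.
by rewrite -E0 -E1 (mulrA _ (V 0 s)) (mulrA _ (V 1 s)) -mulrDl direction_a mul0r.
Qed.

End OneFamily.

(** * Both families together: parallelism of the direction and curvature *)

Variables (om0 om1 : 'I_2 -> one_form R 4) (e0 e1 : R).
Variable b : 'I_2 -> 'I_2 -> 'I_2 -> 'I_2 -> 'rV[R]_4 -> R.
Hypotheses (som0 : forall i, smooth U (om0 i)) (som1 : forall i, smooth U (om1 i)).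
Hypothesis tangent0 : forall s v, W s ->
  a 0 (f s) * ev (om0 0) (f s) ('D_v f s) + a 1 (f s) * ev (om0 1) (f s) ('D_v f s) = 0.
Hypothesis tangent1 : forall s v, W s ->
  a 0 (f s) * ev (om1 0) (f s) ('D_v f s) + a 1 (f s) * ev (om1 1) (f s) ('D_v f s) = 0.
Hypothesis dom0 : forall i x (v w : 'rV[R]_4), U x -> ext_d (om0 i) x v w =
  \sum_j wedge1 (om0 j) (conn j i) x v w
  + e0 * \sum_j a j x * wedge1 (om0 j) (om0 i) x v w.
Hypothesis dom1 : forall i x (v w : 'rV[R]_4), U x -> ext_d (om1 i) x v w =
  \sum_j wedge1 (om1 j) (conn j i) x v w
  + e1 * \sum_j a j x * wedge1 (om1 j) (om1 i) x v w.
Hypothesis dconn : forall i j x (v w : 'rV[R]_4), U x ->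
  ext_d (conn j i) x v w - \sum_k wedge1 (conn j k) (conn k i) x v w =
  \sum_k \sum_l b i j k l x * wedge1 (om0 k) (om1 l) x v w.
Let th0 := contracted_form om0.
Let th1 := contracted_form om1.
Hypothesis nondeg : forall s v, W s -> ev th0 s v = 0 -> ev th1 s v = 0 -> v = 0.

(** By [family_annihilated], the contraction of [N] with [a] has zero exterior product with the two
    independent forms, so it vanishes; by [direction_spans] the components of [N] are then [V] times
    their contraction with [c], which is [ga]. *)
Lemma cov_parallel i s v : W s -> N i s v = V i s * ev ga s v.
Proof.
move=> Ws; rewrite ev_web_conn//; apply: (@direction_spans s (fun i => N i s v)) => //.
have O := wedge_frame_neq0 nondeg Ws.
apply: (mulfI O); rewrite mulr0.
have A0 := family_annihilated som0 tangent0 dom0.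
have A1 := family_annihilated som1 tangent1 dom1.
have [k0 k1] : a 0 (f s) * N 0 s (delta_mx 0 0) + a 1 (f s) * N 1 s (delta_mx 0 0) = 0
    /\ a 0 (f s) * N 0 s (delta_mx 0 1) + a 1 (f s) * N 1 s (delta_mx 0 1) = 0.
  by apply: (plane_proportional O); rewrite [LHS]mulrC [RHS]mulrC;
    [exact: A0|exact: A1].
(* The contraction is known to vanish on the basis vectors only. Comparing [v] with each of them
   makes its value at [v], multiplied by either coefficient of [th1], zero, and hence also
   multiplied by [Om]. *)
have := A1 s (delta_mx 0 0) v Ws; have := A1 s (delta_mx 0 1) v Ws.
rewrite k0 k1 !mulr0 mulrBl; set A := _ + _ => z1 z0.
by rewrite -(mulrA (ev th0 s (delta_mx 0 0))) -(mulrA (ev th0 s (delta_mx 0 1)))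
  z0 z1 !mulr0 subrr.
Qed.

(* Exterior derivative of [cov_parallel]. *)
Lemma web_curvature i s v w : W s ->
  V i s * ext_d ga s v w =
  (\sum_j \sum_k \sum_l b i j k l (f s) * V j s * V k s * V l s) *
  wedge1 th0 th1 s v w.
Proof.
move=> Ws.
have DV u j t : W t -> 'D_u (V j) t = V j t * ev ga t u - \sum_k V k t * ev (C k j) t u.
  by move=> Wt; rewrite -cov_parallel// /N /cov addrK.
have DD u u' : 'D_u ('D_u' (V i)) s =
    V i s * 'D_u (fun t => ev ga t u') s + ev ga s u' * 'D_u (V i) s
    - \sum_j (V j s * 'D_u (fun t => ev (C j i) t u') s + ev (C j i) s u' * 'D_u (V j) s).
  have D0 : is_derive s u (fun t => V i t * ev ga t u')
      (V i s * 'D_u (fun t => ev ga t u') s + ev ga s u' * 'D_u (V i) s).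
    apply: is_deriveM; apply: derivableP; apply: diff_derivable.
      exact: (smooth_direction i 1%N).1.
    exact: (sev u' smooth_web_conn 1%N).1.
  have D1 : is_derive s u (\sum_j (fun t => V j t * ev (C j i) t u'))
      (\sum_j (V j s * 'D_u (fun t => ev (C j i) t u') s
        + ev (C j i) s u' * 'D_u (V j) s)).
    apply: is_derive_sum => j; apply: is_deriveM; apply: derivableP; apply: diff_derivable.
      exact: (smooth_direction j 1%N).1.
    exact: (sev u' (smooth_C j i) 1%N).1.
  have [_ <-] := is_deriveB D0 D1.
  apply: near_eq_derive; have := near_open oW Ws; apply: filterS => t Wt.
  by rewrite DV// -[RHS]/(_ - _) fct_sumE.
have := derive_swap v w oW (smooth_direction i 2%N) Ws.
rewrite !DD => E.
(* The pulled-back curvature equation: [omega_(1)^k /\ omega_(2)^l] becomes [V^k V^l] times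
   [th0 /\ th1]. *)
have dC j : ext_d (C j i) s v w = \sum_k wedge1 (C j k) (C k i) s v w +
    \sum_k \sum_l b i j k l (f s) * (V k s * V l s * wedge1 th0 th1 s v w).
  rewrite (ext_d_pullback oW sf fU v w (sconn i j) Ws).
  apply/eqP; rewrite addrC -subr_eq; apply/eqP.
  have D := dconn i j ('D_v f s) ('D_w f s) (fU Ws).
  rewrite sum2 /C /conn_on !(wedge1_pullback sf _ _ _ _ Ws).
  rewrite sum2 in D; apply: etrans D _.
  rewrite !sum2 -!(wedge1_pullback sf _ _ _ _ Ws) /wedge1.
  rewrite !(ev_family tangent0)// !(ev_family tangent1)// -/th0 -/th1 -/V.
  ring.
move: E (dC 0) (dC 1); rewrite !sum2 !DV// !sum2 /ext_d /wedge1.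
(* Equality of the mixed derivatives of [V i], with first derivatives eliminated by [DV]. The terms
   quadratic in the connection cancel against those of [dC], the mixed terms in [ga] and the
   connection cancel under alternation, and only the curvature terms [O0], [O1] remain. *)
have alg (vi V0 V1 gv gw c0v c1v c0w c1w a00v a01v a10v a11v
    a00w a01w a10w a11w X0 X1 Y0 Y1 A B O0 O1 : R) :
  vi * A + gw * (vi * gv - (V0 * c0v + V1 * c1v)) -
    (V0 * X0 + c0w * (V0 * gv - (V0 * a00v + V1 * a10v)) +
     (V1 * X1 + c1w * (V1 * gv - (V0 * a01v + V1 * a11v)))) =
  vi * B + gv * (vi * gw - (V0 * c0w + V1 * c1w)) -
    (V0 * Y0 + c0v * (V0 * gw - (V0 * a00w + V1 * a10w)) +
     (V1 * Y1 + c1v * (V1 * gw - (V0 * a01w + V1 * a11w)))) ->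
  X0 - Y0 = a00v * c0w - a00w * c0v + (a01v * c1w - a01w * c1v) + O0 ->
  X1 - Y1 = a10v * c0w - a10w * c0v + (a11v * c1w - a11w * c1v) + O1 ->
  vi * (A - B) = V0 * O0 + V1 * O1.
  move=> E H0 H1.
  have -> : O0 = X0 - Y0 - (a00v * c0w - a00w * c0v + (a01v * c1w - a01w * c1v)).
    by rewrite H0; ring.
  have -> : O1 = X1 - Y1 - (a10v * c0w - a10w * c0v + (a11v * c1w - a11w * c1v)).
    by rewrite H1; ring.
  apply/eqP; rewrite -subr_eq0; apply/eqP; move/eqP: E; rewrite -subr_eq0 => /eqP E.
  by apply: etrans _ E; ring.
move=> E H0 H1; apply: etrans (alg _ _ _ _ _ _ _ _ _ _ _ _ _ _ _ _ _ _ _ _ _ _ _ _ _ E H0 H1) _.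
ring.
Qed.

(** Contraction with three copies of [V] sees only the part of [b] symmetric in the lower indices,
    and the three denominators produce the cube of the determinant. *)
Lemma b_contr_direction i s : W s ->
  \sum_j \sum_k \sum_l b i j k l (f s) * V j s * V k s * V l s = b_contr a c b i (f s).
Proof.
move=> Ws; have := hD (fU Ws); rewrite !sum2 /V /direction/= /b_contr /sym3 /coframe_det.
by move=> D; field; rewrite D.
Qed.

Lemma closed_iff_b_contr :
  (forall s v w, W s -> ext_d ga s v w = 0) <->
  (forall s i, W s -> b_contr a c b i (f s) = 0).
Proof.
split=> [cl s i Ws|b0 s v w Ws].
  have O := wedge_frame_neq0 nondeg Ws; apply: (mulIf O); rewrite mul0r.
  have := web_curvature i (delta_mx 0 0) (delta_mx 0 1) Ws.
  by rewrite cl// mulr0 b_contr_direction// => <-.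
rewrite -[LHS]mul1r -(direction_c Ws) mulrDl -(mulrA (c 0 (f s)))
  -(mulrA (c 1 (f s))) (web_curvature 0 v w Ws) (web_curvature 1 v w Ws).
by rewrite !b_contr_direction// !b0// !mul0r !mulr0 addr0.
Qed.

End Reduction.

(** Independence of the four covectors makes the square matrix with these columns invertible, so
    only the zero vector is annihilated by all of them. *)
Lemma coframe_injective (R : realType) (w : 'I_2 -> 'I_2 -> 'cV[R]_4) :
  (forall k1 k2 : 'I_2 -> R,
     \sum_i (k1 i *: w 0 i + k2 i *: w 1 i) = 0 -> forall i, k1 i = 0 /\ k2 i = 0) ->
  forall y : 'rV[R]_4, (forall j i, (y *m w j i) 0 0 = 0) -> y = 0.
Proof.
move=> ind y yw.
pose A : 'M[R]_(4, (1 + 1) + (1 + 1)) := row_mx (row_mx (w 0 0) (w 0 1)) (row_mx (w 1 0) (w 1 1)).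
have fA : row_free A^T.
  apply: inj_row_free => v.
  rewrite /A !tr_row_mx -[v]hsubmxK -[lsubmx v]hsubmxK -[rsubmx v]hsubmxK !mul_row_col.
  rewrite [lsubmx (lsubmx v)]mx11_scalar [rsubmx (lsubmx v)]mx11_scalar.
  rewrite [lsubmx (rsubmx v)]mx11_scalar [rsubmx (rsubmx v)]mx11_scalar.
  move: (lsubmx (lsubmx v) 0 0) (rsubmx (lsubmx v) 0 0) => k00 k01.
  move: (lsubmx (rsubmx v) 0 0) (rsubmx (rsubmx v) 0 0) => k10 k11.
  rewrite !mul_scalar_mx => E.
  have := ind (fun i => if i == 0 then k00 else k01) (fun i => if i == 0 then k10 else k11).
  rewrite sum2 /= => H.
  have {}H : forall i : 'I_2, (if i == 0 then k00 else k01) = 0 /\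
      (if i == 0 then k10 else k11) = 0.
    apply: H; apply: trmx_inj; rewrite trmx0 -E !linearD/= !linearZ/=.
    by rewrite addrACA.
  have [/= -> ->] := H 0; have [/= -> ->] := H 1.
  by rewrite !raddf0 !row_mx0.
have uA : (A : 'M[R]_4) \in unitmx by rewrite -unitmx_tr -row_free_unit.
have z j i : y *m w j i = 0 by apply/matrixP => r k; rewrite !ord1 yw mxE.
have yA : y *m A = 0 by rewrite /A !mul_mx_row !z !row_mx0.
by apply: (can_inj (mulmxK uA)); rewrite mul0mx; exact: yA.
Qed.

Unset Implicit Arguments.
Set Strict Implicit.

Theorem theorem9 (R : realType) (U : set 'rV[R]_4)
    (lam : 'I_3 -> vdistribution R 4)
    (omega : 'I_3 -> 'I_2 -> one_form R 4)
    (conn : 'I_2 -> 'I_2 -> one_form R 4)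
    (a : 'I_2 -> 'rV[R]_4 -> R)
    (b : 'I_2 -> 'I_2 -> 'I_2 -> 'I_2 -> 'rV[R]_4 -> R)
    (p q : 'I_2 -> 'I_2 -> 'rV[R]_4 -> R)
    (hU : open U)
    (hweb : web322 U lam)
    (homega : normalized_coframe U lam omega)
    (hstruct : structure_equations U omega conn a b p q)
    (ha : forall x, U x -> exists i, a i x != 0)
    (hint : integrable_distribution U (a_distribution omega a))
    (c : 'I_2 -> 'rV[R]_4 -> R)
    (hc : forall i, smooth U (c i))
    (hD : forall x, U x -> coframe_det a c x != 0) :
  (forall (W : set 'rV[R]_2) (f : 'rV[R]_2 -> 'rV[R]_4),
     integral_surface U (a_distribution omega a) W f ->
     hexagonal W (cut_web lam f)) <->
  (forall x, U x -> b_contr a c b 0 x = 0 /\ b_contr a c b 1 x = 0).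
Proof.
have [somega lamE wsum wfree] := homega.
have [sconn sa s1 s2 scn _ _ _] := hstruct.
have lift W f : integral_surface U (a_distribution omega a) W f ->
    hexagonal W (cut_web lam f) <->
    (forall s i, W s -> b_contr a c b i (f s) = 0).
  move=> [oW sf fU fD].
  have tan s v : W s -> a_distribution omega a (f s) ('D_v f s).
    move=> Ws; have [_ <-] := fD s Ws; exists v => //.
    by rewrite deriveE//; exact: (sf 1%N).1.
  have t0 s v : W s -> a 0 (f s) * ev (omega 0 0) (f s) ('D_v f s) +
      a 1 (f s) * ev (omega 0 1) (f s) ('D_v f s) = 0.
    by move=> Ws; have [] := tan s v Ws.
  have t1 s v : W s -> a 0 (f s) * ev (omega 1 0) (f s) ('D_v f s) +
      a 1 (f s) * ev (omega 1 1) (f s) ('D_v f s) = 0.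
    by move=> Ws; have [] := tan s v Ws.
  have d0 i x (v w : 'rV[R]_4) : U x -> ext_d (omega 0 i) x v w =
      \sum_j wedge1 (omega 0 j) (conn j i) x v w
      + 1 * \sum_j a j x * wedge1 (omega 0 j) (omega 0 i) x v w.
    by move=> Ux; rewrite mul1r; exact: s1.
  have d1 i x (v w : 'rV[R]_4) : U x -> ext_d (omega 1 i) x v w =
      \sum_j wedge1 (omega 1 j) (conn j i) x v w
      + -1 * \sum_j a j x * wedge1 (omega 1 j) (omega 1 i) x v w.
    by move=> Ux; rewrite mulN1r; exact: s2.
  pose th0 := contracted_form f c (omega 0); pose th1 := contracted_form f c (omega 1).
  have dec0 i s v : W s -> ev (omega 0 i) (f s) ('D_v f s) =
      direction f a c i s * ev th0 s v.
    by move=> Ws; rewrite -(ev_pullback sf _ _ Ws); exact: (ev_family sf fU hD t0).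
  have dec1 i s v : W s -> ev (omega 1 i) (f s) ('D_v f s) =
      direction f a c i s * ev th1 s v.
    by move=> Ws; rewrite -(ev_pullback sf _ _ Ws); exact: (ev_family sf fU hD t1).
  (* If both [theta] vanish on [v], so do all four forms of the coframe on its image under the
     differential of [f], which is injective. *)
  have nondeg s v : W s -> ev th0 s v = 0 -> ev th1 s v = 0 -> v = 0.
    move=> Ws z0 z1; have [inj _] := fD s Ws; apply: inj.
    rewrite linear0 -deriveE; last exact: (sf 1%N).1.
    apply: (@coframe_injective R (fun j i => omega (if j == 0 then 0 else 1) i (f s))).
      by move=> k1 k2; apply: wfree; exact: fU.
    move=> j i; rewrite -/(ev _ _ _); case: (j == 0).
      by rewrite dec0// z0 mulr0.
    by rewrite dec1// z1 mulr0.
  (* Since the contraction of the direction with [c] is 1, the two conditions [omega_(u)^i = 0] on a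
     leaf reduce to the single equation [theta_u = 0] on the surface. *)
  have dir0 s (x : R) : W s -> (forall i, direction f a c i s * x = 0) <-> x = 0.
    move=> Ws; split=> [H|-> i]; last by rewrite mulr0.
    rewrite -[x]mul1r -(direction_c fU hD Ws) mulrDl.
    by rewrite -(mulrA (c 0 (f s))) -(mulrA (c 1 (f s))) !H !mulr0 addr0.
  have D s v : W s -> 'd f s v = 'D_v f s.
    by move=> Ws; rewrite deriveE//; exact: (sf 1%N).1.
  have F0 s : W s -> cut_web lam f 0 s = [set v | ev th0 s v = 0].
    move=> Ws; apply/funext => v; apply/propext; rewrite /cut_web /= lamE; last exact: fU.
    rewrite /= -(dir0 s)// D//; split=> H i; first by rewrite -dec0.
    by rewrite dec0.
  have F1 s : W s -> cut_web lam f 1 s = [set v | ev th1 s v = 0].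
    move=> Ws; apply/funext => v; apply/propext; rewrite /cut_web /= lamE; last exact: fU.
    rewrite /= -(dir0 s)// D//; split=> H i; first by rewrite -dec1.
    by rewrite dec1.
  have F2 s : W s -> cut_web lam f ord_max s = [set v | ev th0 s v + ev th1 s v = 0].
    move=> Ws; apply/funext => v; apply/propext; rewrite /cut_web /= lamE; last exact: fU.
    (* The normalization of the coframe expresses the third pair of forms as minus the sum of the
       first two. *)
    have ev2 i : ev (omega ord_max i) (f s) ('D_v f s) =
        - (direction f a c i s * (ev th0 s v + ev th1 s v)).
      rewrite mulrDr -dec0// -dec1//; apply/eqP; rewrite -addr_eq0; apply/eqP.
      have := wsum i (f s) (fU s Ws).
      have o1 : lift ord0 ord0 = 1 :> 'I_3 by apply: val_inj.
      have o2 : lift ord0 (lift ord0 ord0) = ord_max :> 'I_3 by apply: val_inj.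
      rewrite !big_ord_recl big_ord0 addr0 o1 o2.
      move=> /(congr1 (fun M => ('D_v f s *m M) 0 0)).
      rewrite mulmx0 !mulmxDr !mxE => E; apply: etrans _ E.
      by rewrite /ev !mxE [LHS]addrC -[LHS]addrA.
    rewrite /= -(dir0 s)// D//; split=> H i.
      by apply: oppr_inj; rewrite oppr0 -ev2.
    by rewrite ev2 H oppr0.
  have sth0 : smooth W th0 by exact: smooth_contracted_form (somega 0).
  have sth1 : smooth W th1 by exact: smooth_contracted_form (somega 1).
  have sga := smooth_web_conn hU oW sf fU sconn sa hc hD.
  have dth0 := contracted_form_structure hU oW sf fU sa hc hD (somega 0) t0 d0.
  have dth1 := contracted_form_structure hU oW sf fU sa hc hD (somega 1) t1 d1.
  rewrite -(closed_iff_b_contr hU oW sf fU sconn sa hc hD (somega 0) (somega 1)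
    t0 t1 d0 d1 scn nondeg).
  split; first exact: (hexagonal_closed oW sth0 sth1 sga nondeg dth0 dth1 F0 F1 F2).
  exact: (closed_hexagonal oW sth0 sth1 sga nondeg dth0 dth1 F0 F1 F2).
split=> [hex x Ux|b0 W f Wf].
  (* Integrability provides a surface through every point of [U], so the conditions along the
     surfaces give the pointwise relations. *)
  have [W [f [s [Wf Ws <-]]]] := hint x Ux.
  by have /(lift W f Wf) b0 := hex W f Wf; split; exact: b0.
apply/(lift W f Wf) => s i Ws.
have [_ _ fU _] := Wf; have [b00 b01] := b0 (f s) (fU s Ws).
by case: i => [[|[|]]] // Hi; [rewrite (_ : Ordinal Hi = 0)
  |rewrite (_ : Ordinal Hi = 1)] => //; apply: val_inj.
Qed.
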